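(* Let $k_1,k_2>0$ and choose $\tilde\delta>0$ with $$\tilde\delta<\min\left(\frac1{L\eta},\ \frac{2k_1\alpha_1}{\alpha_1\rho+k_1^2},\ \frac{4k_2\beta}{2\alpha_1\beta\mu+\left(1+\frac{2\gamma^2\beta}{\alpha_1}\right)k_2^2}\right).$$ Define the positive constants $$\begin{aligned}C_1:=\max\Big(&\tfrac1\rho+\tilde\delta L\sqrt{\tfrac\rho{\alpha_1}},\ \tfrac1\mu+\tilde\delta L\sqrt{\tfrac\mu\beta}\left(1+\gamma\tfrac\beta{\alpha_1}\right),\ 1+\tilde\delta L\left(\sqrt{\tfrac\rho{\alpha_1}}+\gamma\sqrt{\tfrac\mu{\alpha_1}}\right),\\&1+\tilde\delta L\gamma\sqrt{\tfrac\mu\beta},\ 1+\tilde\delta L\left(\gamma\sqrt{\tfrac1{\rho\alpha_1}}+\sqrt{\tfrac1{\mu\alpha_1}}\right),\ \tfrac1\mu+\tilde\delta L\left(\tfrac\gamma{\sqrt{\alpha_1\mu}}+\tfrac1{\sqrt{\beta\mu}}\right)\Big),\\ C_2:=\max(&\rho,\ \mu,\ \alpha+\gamma^2\beta,\ 2\beta).\end{aligned}$$ If $u^1(x,t),u^2(x,t),w^1(x,t),w^2(x,t)\in C^1([0,\infty);C^3[0,L])$ solve the PDE system (P) and $\{(u^1,u^2,w^1,w^2)_j(t)\}_{j=0}^{N+1}$ solves the semi-discrete system (S) (both systems are given in the context), then the error functions $\{(\theta^1,\theta^2,\eta^1,\eta^2)_j(t)\}_{j=0}^{N+1}$ satisfy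 the error system (R) of the context, and the following exponential stability result holds: there is a constant $D>0$, independent of $h$, such that the residuals satisfy $|r^1_{j+\frac12}(t)|,|r^2_{j+\frac12}(t)|,|s^1_{j+\frac12}(t)|,|s^2_{j+\frac12}(t)|\le Dh^2$ for all $j$ and all $t\ge0$, and with this $D$ $$e_h(t)\le\frac{1+\tilde\delta L\eta}{1-\tilde\delta L\eta}\,e^{-\frac{\tilde\delta(1-\tilde\delta L\eta)}2t}\,e_h(0)+\frac{2C_1^2C_2D^2h^4}{\tilde\delta^2(1-\tilde\delta L\eta)^2}.$$
   Context: Let $L>0$ and let $\rho,\mu,\alpha,\beta,\gamma$ be positive constants with $\alpha_1:=\alpha-\gamma^2\beta>0$. Put $\eta:=\max\left(\sqrt{\frac{\rho}{\alpha_1}}+\sqrt{\frac{\mu\gamma^2}{\alpha_1}},\ \sqrt{\frac{\mu}{\beta}}+\sqrt{\frac{\mu\gamma^2}{\alpha_1}}\right)$ (a number; the error functions $\eta^1_j,\eta^2_j$ below are different objects). A dot denotes the time derivative. System (P), on $(0,L)\times(0,\infty)$: $$\begin{cases}\rho\dot w^1-\alpha u^1_x+\gamma\beta u^2_x=0,\quad \mu\dot w^2-\beta u^2_x+\gamma\beta u^1_x=0,\\ \dot u^1-w^1_x=0,\quad \dot u^2-w^2_x=0,\\ w^1(0,t)=w^2(0,t)=0,\\ \alpha u^1(L,t)-\gamma\beta u^2(L,t)=-k_1w^1(L,t),\\ \beta u^2(L,t)-\gamma\beta u^1(L,t)=-k_2w^2(L,t),\\ (u^1,w^1,u^2,w^2)(x,0)=\left(\tfrac{d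 v_0}{dx},v_1,\tfrac{d p_0}{dx},p_1\right)(x).\end{cases}$$ For $N\in\mathbb N$ let $h=\frac L{N+1}$, $x_j=jh$ ($j=0,\dots,N+1$). For a grid function $(U_j)_{j=0}^{N+1}$ write $U_{j+\frac12}:=\frac{U_j+U_{j+1}}2$, $\delta_x[U_{j+\frac12}]:=\frac{U_{j+1}-U_j}h$ for $j=0,\dots,N$. System (S), for grid functions $u^1_j(t),u^2_j(t),w^1_j(t),w^2_j(t)$: $$\begin{cases}\dot u^1_{j+\frac12}-\delta_x[w^1_{j+\frac12}]=0,\quad \dot u^2_{j+\frac12}-\delta_x[w^2_{j+\frac12}]=0,\\ \rho\,\dot w^1_{j+\frac12}-\alpha\,\delta_x[u^1_{j+\frac12}]+\gamma\beta\,\delta_x[u^2_{j+\frac12}]=0,\\ \mu\,\dot w^2_{j+\frac12}-\beta\,\delta_x[u^2_{j+\frac12}]+\gamma\beta\,\delta_x[u^1_{j+\frac12}]=0,& j=0,\dots,N,\\ w^1_0=w^2_0=0,\\ \alpha u^1_{N+1}-\gamma\beta u^2_{N+1}=-k_1w^1_{N+1},\\ \beta u^2_{N+1}-\gamma\beta u^1_{N+1}=-k_2w^2_{N+1},\\ (u^1,u^2,w^1,w^2)_j(0)=(u^1,u^2,w^1,w^2)_j^0,& j=0,\dots,N+1,\end{cases}$$ where $(u^1,u^2,w^1,w^2)_j^0$ denotes the discrete initial data, obtained from the initial data of (P) at the grid points; correspondingly the error system (R) below carries a zero initial condition. Let $U^k_j(t):=u^k(x_j,t)$, $W^k_j(t):=w^k(x_j,t)$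 ($k=1,2$) be the nodal values of the solution of (P), and define the residuals, for $j=0,\dots,N$, by $$\begin{aligned}r^k_{j+\frac12}&:=\dot U^k_{j+\frac12}-\delta_x[W^k_{j+\frac12}],\quad k=1,2,\\ s^1_{j+\frac12}&:=\rho\dot W^1_{j+\frac12}-\alpha\delta_x[U^1_{j+\frac12}]+\gamma\beta\delta_x[U^2_{j+\frac12}],\\ s^2_{j+\frac12}&:=\mu\dot W^2_{j+\frac12}-\beta\delta_x[U^2_{j+\frac12}]+\gamma\beta\delta_x[U^1_{j+\frac12}].\end{aligned}$$ The error functions are $\theta^k_j(t):=U^k_j(t)-u^k_j(t)$ and $\eta^k_j(t):=W^k_j(t)-w^k_j(t)$, $k=1,2$, where $u^k_j,w^k_j$ solve (S). Error system (R): $$\begin{cases}\rho\dot\eta^1_{j+\frac12}-\alpha\delta_x[\theta^1_{j+\frac12}]+\gamma\beta\delta_x[\theta^2_{j+\frac12}]=s^1_{j+\frac12}(t),\\ \mu\dot\eta^2_{j+\frac12}-\beta\delta_x[\theta^2_{j+\frac12}]+\gamma\beta\delta_x[\theta^1_{j+\frac12}]=s^2_{j+\frac12}(t),\\ \dot\theta^1_{j+\frac12}-\delta_x[\eta^1_{j+\frac12}]=r^1_{j+\frac12}(t),\quad \dot\theta^2_{j+\frac12}-\delta_x[\eta^2_{j+\frac12}]=r^2_{j+\frac12}(t),& j=0,\dots,N,\\ \eta^1_0=\eta^2_0=0,\quad \alpha\theta^1_{N+1}-\gamma\beta\theta^2_{N+1}=-k_1\eta^1_{N+1},\\ \beta\theta^2_{N+1}-\gamma\beta\theta^1_{N+1}=-k_2\eta^2_{N+1},\\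 (\theta^1_j,\theta^2_j,\eta^1_j,\eta^2_j)(0)=(0,0,0,0),& j=0,\dots,N+1.\end{cases}$$ The error energy is $$e_h(t):=\frac h2\sum_{j=0}^N\left(\rho|\eta^1_{j+\frac12}|^2+\mu|\eta^2_{j+\frac12}|^2+\beta|\gamma\theta^1_{j+\frac12}-\theta^2_{j+\frac12}|^2+\alpha_1|\theta^1_{j+\frac12}|^2\right).$$ *)

(* Defs.v *)
From Stdlib Require Import Reals Lra.
From Coquelicot Require Import Coquelicot.
Open Scope R_scope.

(* Derivatives relative to a set: the difference quotient at [x] is taken over
   points of [D] only, so it is one-sided at an end point of an interval. *)

Definition derivable_in (D : R -> Prop) (f : R -> R) (x : R) : Prop :=
  exists l : R, D_in f (fun _ => l) D x.

Definition Derive_in (D : R -> Prop) (f : R -> R) (x : R) : R :=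
  iota (fun l : R => D_in f (fun _ => l) D x).

Fixpoint Derive_n_in (D : R -> Prop) (n : nat) (f : R -> R) : R -> R :=
  match n with
  | O => f
  | S m => Derive_in D (Derive_n_in D m f)
  end.

Definition Icc (L x : R) : Prop := 0 <= x <= L.
Definition Ici (t : R) : Prop := 0 <= t.

Notation Dt := (Derive_in Ici).
Notation Dx L := (Derive_in (Icc L)).

Lemma Derive_in_unique (D : R -> Prop) (f : R -> R) (x l : R) :
  adhDa (D_x D x) x -> D_in f (fun _ => l) D x -> Derive_in D f x = l.
Proof.
  intros Had Hl. unfold Derive_in.
  apply (@iota_unique R_AbsRing R_CompleteNormedModule); [ | exact Hl].
  intros y Hy. exact (single_limit _ _ _ _ _ Had Hy Hl).
Qed.

Lemma adhDa_Ici (t : R) : 0 <= t -> adhDa (D_x Ici t) t.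
Proof.
  intros Ht e He. exists (t + e / 2).
  unfold D_x, Ici, Rdist. rewrite Rabs_pos_eq; lra.
Qed.

Lemma adhDa_Icc (L x : R) : 0 < L -> Icc L x -> adhDa (D_x (Icc L) x) x.
Proof.
  unfold Icc. intros HL Hx e He. set (d := Rmin (e / 2) (L / 2)).
  assert (Hd : 0 < d) by (apply Rmin_pos; lra).
  assert (H1 : d <= e / 2) by apply Rmin_l.
  assert (H2 : d <= L / 2) by apply Rmin_r.
  unfold D_x, Icc, Rdist. destruct (Rle_dec x (L / 2)).
  - exists (x + d). rewrite Rabs_pos_eq; lra.
  - exists (x - d). rewrite Rabs_left; lra.
Qed.

(* The Banach space C^k[0,L] and its norm max_{i<=k} sup_{[0,L]} |f^(i)|. *)

Definition in_Ck (k : nat) (L : R) (f : R -> R) : Prop :=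
  (forall (i : nat) (x : R), (i < k)%nat -> Icc L x ->
     derivable_in (Icc L) (Derive_n_in (Icc L) i f) x) /\
  (forall x : R, Icc L x -> continue_in (Derive_n_in (Icc L) k f) (Icc L) x).

Definition Ck_norm (k : nat) (L : R) (f : R -> R) : Rbar :=
  Lub_Rbar (fun y : R => exists (i : nat) (x : R),
    (i <= k)%nat /\ Icc L x /\ y = Rabs (Derive_n_in (Icc L) i f x)).

(* [f] is in C^1([0,oo); C^k[0,L]): the map t |-> f(.,t) has a derivative
   t |-> g(.,t) in the norm of C^k[0,L], and this derivative is continuous
   in the same norm. *)
Definition in_C1_Ck (k : nat) (L : R) (f : R -> R -> R) : Prop :=
  (forall t : R, 0 <= t -> in_Ck k L (fun x => f x t)) /\
  exists g : R -> R -> R,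
    (forall t : R, 0 <= t -> in_Ck k L (fun x => g x t)) /\
    (forall t eps : R, 0 <= t -> 0 < eps -> exists d : R, 0 < d /\
       forall s : R, 0 <= s -> s <> t -> Rabs (s - t) < d ->
         Rbar_lt (Ck_norm k L (fun x => (f x s - f x t) / (s - t) - g x t)) eps) /\
    (forall t eps : R, 0 <= t -> 0 < eps -> exists d : R, 0 < d /\
       forall s : R, 0 <= s -> Rabs (s - t) < d ->
         Rbar_lt (Ck_norm k L (fun x => g x s - g x t)) eps).

Definition systemP (L rho mu alpha beta gamma k1 k2 : R)
    (v0 v1 p0 p1 : R -> R) (u1 u2 w1 w2 : R -> R -> R) : Prop :=
  (forall x t : R, 0 < x < L -> 0 < t ->
     rho * Dt (w1 x) t - alpha * Dx L (fun y => u1 y t) x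
       + gamma * beta * Dx L (fun y => u2 y t) x = 0 /\
     mu * Dt (w2 x) t - beta * Dx L (fun y => u2 y t) x
       + gamma * beta * Dx L (fun y => u1 y t) x = 0 /\
     Dt (u1 x) t - Dx L (fun y => w1 y t) x = 0 /\
     Dt (u2 x) t - Dx L (fun y => w2 y t) x = 0) /\
  (forall t : R, 0 < t ->
     w1 0 t = 0 /\ w2 0 t = 0 /\
     alpha * u1 L t - gamma * beta * u2 L t = - k1 * w1 L t /\
     beta * u2 L t - gamma * beta * u1 L t = - k2 * w2 L t) /\
  (forall x : R, Icc L x ->
     derivable_in (Icc L) v0 x /\ derivable_in (Icc L) p0 x /\
     u1 x 0 = Dx L v0 x /\ w1 x 0 = v1 x /\
     u2 x 0 = Dx L p0 x /\ w2 x 0 = p1 x).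

(* Grid functions are maps [U : nat -> R -> R], (j, t) |-> U_j(t), of which only
   the indices j <= N+1 matter. *)

Definition mesh (L : R) (N : nat) : R := L / INR (N + 1).
Definition node (L : R) (N j : nat) : R := INR j * mesh L N.

(* [mid U j] is U_{j+1/2} and [delta h U j] is delta_x[U_{j+1/2}]. *)
Definition mid (U : nat -> R -> R) (j : nat) (t : R) : R :=
  (U j t + U (S j) t) / 2.
Definition delta (h : R) (U : nat -> R -> R) (j : nat) (t : R) : R :=
  (U (S j) t - U j t) / h.

Definition lhs_u (h : R) (u w : nat -> R -> R) (j : nat) (t : R) : R :=
  Dt (mid u j) t - delta h w j t.
Definition lhs_w1 (h rho alpha beta gamma : R)
    (w1 u1 u2 : nat -> R -> R) (j : nat) (t : R) : R :=
  rho * Dt (mid w1 j) t - alpha * delta h u1 j t + gamma * beta * delta h u2 j t.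
Definition lhs_w2 (h mu beta gamma : R)
    (w2 u1 u2 : nat -> R -> R) (j : nat) (t : R) : R :=
  mu * Dt (mid w2 j) t - beta * delta h u2 j t + gamma * beta * delta h u1 j t.

Definition scheme (L rho mu alpha beta gamma k1 k2 : R) (N : nat)
    (r1 r2 s1 s2 : nat -> R -> R) (a1 a2 b1 b2 : nat -> R)
    (u1 u2 w1 w2 : nat -> R -> R) : Prop :=
  let h := mesh L N in
  (forall (j : nat) (t : R), (j <= N + 1)%nat -> 0 <= t ->
     derivable_in Ici (u1 j) t /\ derivable_in Ici (u2 j) t /\
     derivable_in Ici (w1 j) t /\ derivable_in Ici (w2 j) t) /\
  (forall (j : nat) (t : R), (j <= N)%nat -> 0 <= t ->
     lhs_u h u1 w1 j t = r1 j t /\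
     lhs_u h u2 w2 j t = r2 j t /\
     lhs_w1 h rho alpha beta gamma w1 u1 u2 j t = s1 j t /\
     lhs_w2 h mu beta gamma w2 u1 u2 j t = s2 j t) /\
  (forall t : R, 0 <= t ->
     w1 0%nat t = 0 /\ w2 0%nat t = 0 /\
     alpha * u1 (N + 1)%nat t - gamma * beta * u2 (N + 1)%nat t
       = - k1 * w1 (N + 1)%nat t /\
     beta * u2 (N + 1)%nat t - gamma * beta * u1 (N + 1)%nat t
       = - k2 * w2 (N + 1)%nat t) /\
  (forall j : nat, (j <= N + 1)%nat ->
     u1 j 0 = a1 j /\ u2 j 0 = a2 j /\ w1 j 0 = b1 j /\ w2 j 0 = b2 j).

(* The semi-discretization of [systemP]: zero sources, and the initial data of
   [systemP] sampled at the nodes. *)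
Definition systemS (L rho mu alpha beta gamma k1 k2 : R) (N : nat)
    (v0 v1 p0 p1 : R -> R) (u1 u2 w1 w2 : nat -> R -> R) : Prop :=
  scheme L rho mu alpha beta gamma k1 k2 N
    (fun _ _ => 0) (fun _ _ => 0) (fun _ _ => 0) (fun _ _ => 0)
    (fun j => Dx L v0 (node L N j)) (fun j => Dx L p0 (node L N j))
    (fun j => v1 (node L N j)) (fun j => p1 (node L N j))
    u1 u2 w1 w2.

Definition systemR (L rho mu alpha beta gamma k1 k2 : R) (N : nat)
    (r1 r2 s1 s2 : nat -> R -> R)
    (theta1 theta2 eta1 eta2 : nat -> R -> R) : Prop :=
  scheme L rho mu alpha beta gamma k1 k2 N r1 r2 s1 s2
    (fun _ => 0) (fun _ => 0) (fun _ => 0) (fun _ => 0)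
    theta1 theta2 eta1 eta2.

Definition nodal (L : R) (N : nat) (f : R -> R -> R) (j : nat) (t : R) : R :=
  f (node L N j) t.

(* Residuals r^k ([res_u], from u^k and w^k), s^1 and s^2 ([res_w1], [res_w2]):
   the nodal values inserted in the scheme. *)
Definition res_u (L : R) (N : nat) (u w : R -> R -> R) : nat -> R -> R :=
  lhs_u (mesh L N) (nodal L N u) (nodal L N w).
Definition res_w1 (L rho alpha beta gamma : R) (N : nat)
    (w1 u1 u2 : R -> R -> R) : nat -> R -> R :=
  lhs_w1 (mesh L N) rho alpha beta gamma
    (nodal L N w1) (nodal L N u1) (nodal L N u2).
Definition res_w2 (L mu beta gamma : R) (N : nat)
    (w2 u1 u2 : R -> R -> R) : nat -> R -> R :=
  lhs_w2 (mesh L N) mu beta gamma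
    (nodal L N w2) (nodal L N u1) (nodal L N u2).

Definition err (L : R) (N : nat) (f : R -> R -> R) (F : nat -> R -> R)
    (j : nat) (t : R) : R :=
  nodal L N f j t - F j t.

Definition alpha1 (alpha beta gamma : R) : R := alpha - gamma ^ 2 * beta.

Definition energy (L rho mu alpha beta gamma : R) (N : nat)
    (theta1 theta2 eta1 eta2 : nat -> R -> R) (t : R) : R :=
  mesh L N / 2 * sum_f_R0 (fun j =>
    rho * Rabs (mid eta1 j t) ^ 2 + mu * Rabs (mid eta2 j t) ^ 2
    + beta * Rabs (gamma * mid theta1 j t - mid theta2 j t) ^ 2
    + alpha1 alpha beta gamma * Rabs (mid theta1 j t) ^ 2) N.

Definition eta_const (rho mu alpha beta gamma : R) : R :=
  let a1 := alpha1 alpha beta gamma in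
  Rmax (sqrt (rho / a1) + sqrt (mu * gamma ^ 2 / a1))
       (sqrt (mu / beta) + sqrt (mu * gamma ^ 2 / a1)).

Definition delta_bound (L rho mu alpha beta gamma k1 k2 : R) : R :=
  let a1 := alpha1 alpha beta gamma in
  Rmin (1 / (L * eta_const rho mu alpha beta gamma))
 (Rmin (2 * k1 * a1 / (a1 * rho + k1 ^ 2))
       (4 * k2 * beta /
          (2 * a1 * beta * mu + (1 + 2 * gamma ^ 2 * beta / a1) * k2 ^ 2))).

Definition const_C1 (L rho mu alpha beta gamma dlt : R) : R :=
  let a1 := alpha1 alpha beta gamma in
  Rmax (1 / rho + dlt * L * sqrt (rho / a1))
 (Rmax (1 / mu + dlt * L * sqrt (mu / beta) * (1 + gamma * (beta / a1)))
 (Rmax (1 + dlt * L * (sqrt (rho / a1) + gamma * sqrt (mu / a1)))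
 (Rmax (1 + dlt * L * gamma * sqrt (mu / beta))
 (Rmax (1 + dlt * L * (gamma * sqrt (1 / (rho * a1)) + sqrt (1 / (mu * a1))))
       (1 / mu + dlt * L *
          (gamma / sqrt (a1 * mu) + 1 / sqrt (beta * mu))))))).

Definition const_C2 (rho mu alpha beta gamma : R) : R :=
  Rmax rho (Rmax mu (Rmax (alpha + gamma ^ 2 * beta) (2 * beta))).

(* Main.v *)
Require Import Defs.
From Stdlib Require Import Reals Lra Lia List.
From Coquelicot Require Import Coquelicot.
Open Scope R_scope.

(** The constant [D] only has to dominate the residuals and to make the error
    term large enough, and the initial error vanishes; so it suffices to bound
    the residuals by [O(h^2)] and the energy by [O(h^4)], uniformly in time.

    The scheme is stable: the discrete energy plus a small multiple of the
    discrete multiplier [int x (rho th1 et1 + mu th2 et2) dx] is a Lyapunov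
    functional with a decay rate independent of [h], so the energy is controlled
    by its initial value and the squared supremum of the sources.

    The residuals are trapezoidal errors, so they are [O(h^2)] as soon as the third
    [x]-derivatives of the solution of (P) are bounded on the whole half-line.
    The wave operator turns these into [Z = d_t^3 (u, w)], which again solves the
    system. Difference quotients of [Z] in time, sampled on a grid that is fine
    enough, solve the scheme with bounded sources; scheme stability then bounds
    [d_t Z], hence [d_x Z], in a discrete L^2 norm uniformly in time, and the
    boundary conditions yield a bound for [Z] itself. *)

(** * Derivatives relative to a set *)

(** The regularity class bounds the third [x]-derivatives on bounded time intervals only, whereas
    [D] has to serve all [t >= 0]; this obstacle shapes the proof. The damped boundary conditions
    survive differentiation in [t] but not in [x], so an energy argument is available for time
    derivatives of the solution and not directly for its [x]-derivatives; the equations exchange one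
    kind for the other.

    [Z] has continuous derivatives of first order only, so the energy of [d_t Z] cannot be
    differentiated in time. A difference quotient of [Z] in time keeps one derivative, and the
    scheme measures its energy by finite sums instead of integrals. The mesh of this step is
    auxiliary: it is unrelated to the mesh of the error estimate and may depend on [t], which is
    harmless because the stability constant is the same for every mesh. Thus one discrete stability
    estimate is used twice, for the regularity of the exact solution and for the error. *)

Definition has_deriv (D : R -> Prop) (f : R -> R) (x l : R) : Prop :=
  D_in f (fun _ => l) D x.

Lemma has_deriv_eq (D : R -> Prop) (f : R -> R) (x l m : R) :
  l = m -> has_deriv D f x l -> has_deriv D f x m.
Proof. now intros ->. Qed.

Lemma has_deriv_ext (D : R -> Prop) (f g : R -> R) (x l : R) :
  D x -> (forall y, D y -> f y = g y) -> has_deriv D f x l -> has_deriv D g x l.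
Proof.
  intros Dx E H e He. destruct (H e He) as [a [Ha K]].
  exists a. split; [exact Ha|]. intros y [[Dy N] Hy].
  rewrite <- (E x Dx), <- (E y Dy). apply K. now repeat split.
Qed.

Lemma has_deriv_plus (D : R -> Prop) (f g : R -> R) (x l m : R) :
  has_deriv D f x l -> has_deriv D g x m ->
  has_deriv D (fun y => f y + g y) x (l + m).
Proof. exact (Dadd D (fun _ => l) (fun _ => m) f g x). Qed.

Lemma has_deriv_minus (D : R -> Prop) (f g : R -> R) (x l m : R) :
  has_deriv D f x l -> has_deriv D g x m ->
  has_deriv D (fun y => f y - g y) x (l - m).
Proof. exact (Dminus D (fun _ => l) (fun _ => m) f g x). Qed.

Lemma has_deriv_scal (D : R -> Prop) (c : R) (f : R -> R) (x l : R) :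
  has_deriv D f x l -> has_deriv D (fun y => c * f y) x (c * l).
Proof. exact (Dmult_const D f (fun _ => l) x c). Qed.

Lemma has_deriv_mult (D : R -> Prop) (f g : R -> R) (x l m : R) :
  has_deriv D f x l -> has_deriv D g x m ->
  has_deriv D (fun y => f y * g y) x (l * g x + f x * m).
Proof.
  intros H1 H2. exact (Dmult D (fun _ => l) (fun _ => m) f g x H1 H2).
Qed.

Lemma has_deriv_const (D : R -> Prop) (c x : R) : has_deriv D (fun _ => c) x 0.
Proof. apply Dconst. Qed.

Lemma has_deriv_div (D : R -> Prop) (c : R) (f : R -> R) (x l : R) :
  has_deriv D f x l -> has_deriv D (fun y => f y / c) x (l / c).
Proof.
  intros H. unfold Rdiv. rewrite (Rmult_comm l).
  intros e He. destruct (has_deriv_scal D (/ c) f x l H e He) as [a [Ha K]].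
  exists a. split; [exact Ha|]. intros y Hy.
  replace ((f y * / c - f x * / c) / (y - x))
    with ((/ c * f y - / c * f x) / (y - x)) by (f_equal; ring).
  now apply K.
Qed.

Lemma has_deriv_is_derive (D : R -> Prop) (f : R -> R) (x l : R) :
  is_derive f x l -> has_deriv D f x l.
Proof.
  intros H. apply is_derive_Reals in H.
  apply (proj2 (derivable_pt_lim_D_in f (fun _ => l) x)) in H.
  intros e He. destruct (H e He) as [a [Ha K]].
  exists a. split; [exact Ha|]. intros y [[Dy N] Hy].
  apply K. repeat split; [exact N | exact Hy].
Qed.

Lemma is_derive_has_deriv (D : R -> Prop) (f : R -> R) (x l : R) :
  locally x D -> has_deriv D f x l -> is_derive f x l.
Proof.
  intros [d Hd] H. apply is_derive_Reals.
  apply (proj1 (derivable_pt_lim_D_in f (fun _ => l) x)).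
  intros e He. destruct (H e He) as [a [Ha K]].
  exists (Rmin a d). split; [apply Rmin_pos; [exact Ha | apply cond_pos]|].
  intros y [[_ N] Hy]. apply K. repeat split; [|exact N|].
  - apply Hd. eapply Rlt_le_trans; [exact Hy | apply Rmin_r].
  - eapply Rlt_le_trans; [exact Hy | apply Rmin_l].
Qed.

Lemma has_deriv_Derive_in (D : R -> Prop) (f : R -> R) (x : R) :
  adhDa (D_x D x) x -> derivable_in D f x -> has_deriv D f x (Derive_in D f x).
Proof.
  intros A [l Hl]. now rewrite (Derive_in_unique D f x l A Hl).
Qed.

Lemma has_deriv_unique (D : R -> Prop) (f : R -> R) (x l m : R) :
  adhDa (D_x D x) x -> has_deriv D f x l -> has_deriv D f x m -> l = m.
Proof. intros A H1 H2. exact (single_limit _ _ _ _ _ A H1 H2). Qed.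

(* Unlike [continue_in], this form has no side condition [y <> x]. *)
Definition cont_in (D : R -> Prop) (f : R -> R) (x : R) : Prop :=
  forall e, 0 < e -> exists d, 0 < d /\
    forall y, D y -> Rabs (y - x) < d -> Rabs (f y - f x) < e.

Lemma continue_in_cont_in (D : R -> Prop) (f : R -> R) (x : R) :
  continue_in f D x -> cont_in D f x.
Proof.
  intros H e He. destruct (H e He) as [d [Hd K]]. exists d. split; [exact Hd|].
  intros y Dy Hy. destruct (Req_dec x y) as [<-|N].
  - now rewrite Rminus_diag, Rabs_R0.
  - apply K. now repeat split.
Qed.

Lemma has_deriv_cont_in (D : R -> Prop) (f : R -> R) (x l : R) :
  has_deriv D f x l -> cont_in D f x.
Proof.
  intros H e He. destruct (H 1 Rlt_0_1) as [a [Ha K]].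
  assert (Hl : 0 < Rabs l + 1) by (generalize (Rabs_pos l); lra).
  exists (Rmin a (e / (Rabs l + 1))). split.
  { apply Rmin_pos; [exact Ha | now apply Rdiv_lt_0_compat]. }
  intros y Dy Hy. destruct (Req_dec x y) as [<-|N].
  { now rewrite Rminus_diag, Rabs_R0. }
  assert (Q : Rabs ((f y - f x) / (y - x) - l) < 1).
  { apply K. repeat split; trivial.
    eapply Rlt_le_trans; [exact Hy | apply Rmin_l]. }
  replace (f y - f x) with ((f y - f x) / (y - x) * (y - x)) by (field; lra).
  rewrite Rabs_mult.
  assert (Q' : Rabs ((f y - f x) / (y - x)) < Rabs l + 1).
  { replace ((f y - f x) / (y - x))
      with (((f y - f x) / (y - x) - l) + l) by ring.
    eapply Rle_lt_trans; [apply Rabs_triang | lra]. }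
  assert (Hy' : Rabs (y - x) < e / (Rabs l + 1))
    by (eapply Rlt_le_trans; [exact Hy | apply Rmin_r]).
  assert (0 < Rabs (y - x)) by (apply Rabs_pos_lt; lra).
  apply Rlt_trans with ((Rabs l + 1) * Rabs (y - x)).
  { now apply Rmult_lt_compat_r. }
  apply Rmult_lt_compat_l with (r := Rabs l + 1) in Hy'; [|exact Hl].
  replace ((Rabs l + 1) * (e / (Rabs l + 1))) with e in Hy' by (field; lra).
  exact Hy'.
Qed.

(** Extends the boundary conditions, which (P) states for positive times, to [t = 0]. *)
Lemma cont_in_eq_of_dense (D A : R -> Prop) (f g : R -> R) (x : R) :
  cont_in D f x -> cont_in D g x ->
  (forall d, 0 < d -> exists y, D y /\ A y /\ Rabs (y - x) < d) ->
  (forall y, A y -> f y = g y) -> f x = g x.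
Proof.
  intros Hf Hg Hd E. destruct (Req_dec (f x) (g x)) as [e|N]; [exact e|exfalso].
  assert (P : 0 < Rabs (f x - g x) / 2) by (generalize (Rabs_pos_lt (f x - g x)); lra).
  destruct (Hf _ P) as [a [Ha Ka]], (Hg _ P) as [b [Hb Kb]].
  destruct (Hd (Rmin a b)) as [y [Dy [Ay Hy]]]; [now apply Rmin_pos|].
  specialize (Ka y Dy (Rlt_le_trans _ _ _ Hy (Rmin_l _ _))).
  specialize (Kb y Dy (Rlt_le_trans _ _ _ Hy (Rmin_r _ _))).
  rewrite (E y Ay) in Ka.
  assert (T : Rabs (f x - g x) <= Rabs (g y - f x) + Rabs (g y - g x)).
  { replace (f x - g x) with (- (g y - f x) + (g y - g x)) by ring.
    eapply Rle_trans; [apply Rabs_triang|]. rewrite Rabs_Ropp. lra. }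
  lra.
Qed.

(** * Mean value theorem and Gronwall inequality for one-sided derivatives *)

Definition clamp (a b x : R) : R := Rmax a (Rmin x b).

Lemma clamp_range (a b x : R) : a <= b -> a <= clamp a b x <= b.
Proof.
  intros H. unfold clamp. split; [apply Rmax_l|].
  apply Rmax_lub; [exact H | apply Rmin_r].
Qed.

Lemma clamp_id (a b x : R) : a <= x <= b -> clamp a b x = x.
Proof. intros H. unfold clamp. rewrite Rmin_left, Rmax_right; lra. Qed.

Lemma clamp_lipschitz (a b x y : R) :
  Rabs (clamp a b x - clamp a b y) <= Rabs (x - y).
Proof.
  unfold clamp, Rmax, Rmin.
  repeat destruct Rle_dec; unfold Rabs; repeat destruct Rcase_abs; lra.
Qed.

(** Composition with [clamp] extends a function beyond [[a, b]] by its end values, so that theorems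
    about functions on the whole line or plane apply to functions known on an interval only. *)
Lemma continuity_pt_clamp (D : R -> Prop) (f : R -> R) (a b x : R) :
  a <= b -> (forall y, a <= y <= b -> D y) ->
  (forall y, a <= y <= b -> cont_in D f y) ->
  continuity_pt (fun y => f (clamp a b y)) x.
Proof.
  intros Hab HD Hc e He.
  destruct (Hc _ (clamp_range a b x Hab) e He) as [d [Hd K]].
  exists d. split; [exact Hd|]. intros y [_ Hy]. apply K.
  - apply HD. now apply clamp_range.
  - eapply Rle_lt_trans; [apply clamp_lipschitz | exact Hy].
Qed.

(** Inside the interval a derivative relative to [D] is two-sided; at the end points continuity is
    enough, and the clamped function has it. *)
Lemma MVT_in (D : R -> Prop) (f df : R -> R) (a b : R) :
  a < b -> (forall x, a <= x <= b -> D x) ->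
  (forall x, a <= x <= b -> has_deriv D f x (df x)) ->
  exists c, a <= c <= b /\ f b - f a = df c * (b - a).
Proof.
  intros Hab HD Hf.
  destruct (MVT_gen (fun y => f (clamp a b y)) a b df) as [c [Hc E]].
  - rewrite Rmin_left, Rmax_right by lra. intros x Hx.
    assert (Hloc : locally x (fun y => a <= y <= b)).
    { assert (P : 0 < Rmin (x - a) (b - x)) by (apply Rmin_pos; lra).
      exists (mkposreal _ P). intros y Hy.
      change (Rabs (y - x) < Rmin (x - a) (b - x)) in Hy.
      apply Rabs_lt_between' in Hy.
      generalize (Rmin_l (x - a) (b - x)) (Rmin_r (x - a) (b - x)). lra. }
    apply is_derive_ext_loc with f.
    + revert Hloc. apply filter_imp. intros y Hy. now rewrite clamp_id.
    + apply is_derive_has_deriv with D; [|apply Hf; lra].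
      revert Hloc. now apply filter_imp.
  - intros x _. apply continuity_pt_clamp with D; [lra | exact HD|].
    intros y Hy. exact (has_deriv_cont_in _ _ _ _ (Hf y Hy)).
  - rewrite Rmin_left, Rmax_right in Hc by lra.
    rewrite !clamp_id in E by lra. now exists c.
Qed.

(** The derivative of [(F - b/c) exp(c t)] is nonpositive. The decay of [F 0] is given up in the
    conclusion: the application asks for boundedness uniform in [T]. *)
Lemma gronwall (F dF : R -> R) (c b T : R) :
  0 < c -> 0 <= b -> 0 <= F 0 -> 0 <= T ->
  (forall t, 0 <= t <= T -> has_deriv Ici F t (dF t)) ->
  (forall t, 0 <= t <= T -> dF t <= - c * F t + b) ->
  F T <= F 0 + b / c.
Proof.
  intros Hc Hb HF0 HT HF Hd.
  assert (Hbc : 0 <= b / c) by (apply Rdiv_le_0_compat; assumption).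
  destruct (Req_dec 0 T) as [<-|NT]; [lra|].
  destruct (MVT_in Ici (fun t => (F t - b / c) * exp (c * t))
    (fun t => (dF t - 0) * exp (c * t) + (F t - b / c) * (c * exp (c * t))) 0 T)
    as [t [Ht E]]; [lra | unfold Ici; intros; lra | |].
  - intros t Ht. apply (has_deriv_mult Ici (fun t => F t - b / c) (fun t => exp (c * t))).
    + apply has_deriv_minus; [now apply HF|]. apply (has_deriv_const Ici (b / c)).
    + apply has_deriv_is_derive. auto_derive; [exact I | ring].
  - rewrite Rmult_0_r, exp_0, Rmult_1_r, Rminus_0_r in E.
    assert (M : (dF t - 0) * exp (c * t) + (F t - b / c) * (c * exp (c * t)) <= 0).
    { replace ((dF t - 0) * exp (c * t) + (F t - b / c) * (c * exp (c * t)))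
        with (- ((- c * F t + b - dF t) * exp (c * t))) by (field; lra).
      generalize (Hd t Ht) (exp_pos (c * t)). intros P Q.
      assert (0 <= (- c * F t + b - dF t) * exp (c * t))
        by (apply Rmult_le_pos; lra). lra. }
    assert (P : (F T - b / c) * exp (c * T) <= F 0 - b / c) by nra.
    assert (X : 1 <= exp (c * T)).
    { generalize (exp_ineq1_le (c * T)) (Rmult_le_pos c T (Rlt_le _ _ Hc) HT). lra. }
    destruct (Rle_dec (F T) (b / c)); [lra|]. nra.
Qed.

(** * Stability of the scheme *)

Lemma sum_f_R0_telescope (f : nat -> R) (N : nat) :
  sum_f_R0 (fun j => f (S j) - f j) N = f (S N) - f 0%nat.
Proof. induction N as [|N IH]; simpl; [ring | rewrite IH; ring]. Qed.

Lemma has_deriv_sum (D : R -> Prop) (f : nat -> R -> R) (l : nat -> R) (x : R) (N : nat) :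
  (forall j, (j <= N)%nat -> has_deriv D (f j) x (l j)) ->
  has_deriv D (fun y => sum_f_R0 (fun j => f j y) N) x (sum_f_R0 l N).
Proof.
  induction N as [|N IH]; intros H; simpl; [now apply H|].
  apply has_deriv_plus; [|now apply H]. apply IH. intros j Hj. apply H. lia.
Qed.

Lemma mesh_pos (L : R) (N : nat) : 0 < L -> 0 < mesh L N.
Proof. intros. apply Rdiv_lt_0_compat; [assumption | apply lt_0_INR; lia]. Qed.

Lemma mesh_mult (L : R) (N : nat) : INR (N + 1) * mesh L N = L.
Proof. unfold mesh. field. apply not_0_INR. lia. Qed.

Lemma sum_mesh (L c : R) (N : nat) : sum_f_R0 (fun _ => mesh L N * c) N = L * c.
Proof.
  rewrite sum_cte, <- Nat.add_1_r.
  transitivity (INR (N + 1) * mesh L N * c); [ring | now rewrite mesh_mult].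
Qed.

Lemma node_succ (L : R) (N j : nat) : node L N (S j) = node L N j + mesh L N.
Proof. unfold node. rewrite S_INR. ring. Qed.

Lemma node_range (L : R) (N j : nat) :
  0 < L -> (j <= N + 1)%nat -> Icc L (node L N j).
Proof.
  intros HL Hj. unfold Icc, node. generalize (mesh_pos L N HL) (pos_INR j). intros P Q.
  apply le_INR in Hj. generalize (mesh_mult L N). split; nra.
Qed.

(** * The energy form, the stress and the boundary damping *)

Definition quad (rho mu alpha beta gamma th1 th2 et1 et2 : R) : R :=
  rho * et1 ^ 2 + mu * et2 ^ 2 + beta * (gamma * th1 - th2) ^ 2
  + alpha1 alpha beta gamma * th1 ^ 2.

Lemma energy_quad (L rho mu alpha beta gamma : R) (N : nat)
    (th1 th2 et1 et2 : nat -> R -> R) (t : R) :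
  energy L rho mu alpha beta gamma N th1 th2 et1 et2 t
  = mesh L N / 2 * sum_f_R0 (fun j => quad rho mu alpha beta gamma
      (mid th1 j t) (mid th2 j t) (mid et1 j t) (mid et2 j t)) N.
Proof.
  unfold energy, quad. f_equal. apply sum_eq. intros j _. now rewrite !pow2_abs.
Qed.

(** Writing [b = gamma a - (gamma a - b)] gives [b^2 <= 2 gamma^2 a^2 + 2 (gamma a - b)^2]; this is
    the origin of [alpha1 / (1 + 2 gamma^2)] and [beta / 2]. *)
Lemma quad_lower (rho mu alpha beta gamma : R) :
  0 < rho -> 0 < mu -> 0 < beta -> 0 < alpha1 alpha beta gamma ->
  exists m, 0 < m /\ forall a b c d,
    m * (a ^ 2 + b ^ 2 + c ^ 2 + d ^ 2) <= quad rho mu alpha beta gamma a b c d.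
Proof.
  intros Hr Hm Hb Ha. unfold quad.
  set (a1 := alpha1 alpha beta gamma) in *.
  assert (G : 0 < 1 + 2 * gamma ^ 2) by nra.
  set (p := a1 / (1 + 2 * gamma ^ 2)).
  assert (Hp : 0 < p) by now apply Rdiv_lt_0_compat.
  assert (Ep : a1 = p * (1 + 2 * gamma ^ 2)) by (unfold p; field; lra).
  exists (Rmin (Rmin rho mu) (Rmin p (beta / 2))). split.
  { repeat apply Rmin_pos; lra. }
  intros a b c d. set (m := Rmin _ _).
  assert (M1 : m <= rho) by (unfold m; eapply Rle_trans; apply Rmin_l).
  assert (M2 : m <= mu) by (unfold m; eapply Rle_trans; [apply Rmin_l | apply Rmin_r]).
  assert (M3 : m <= p) by (unfold m; eapply Rle_trans; [apply Rmin_r | apply Rmin_l]).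
  assert (M4 : m <= beta / 2) by (unfold m; eapply Rle_trans; apply Rmin_r).
  assert (0 < m) by (unfold m; repeat apply Rmin_pos; lra).
  assert (X : a ^ 2 + b ^ 2 <= (1 + 2 * gamma ^ 2) * a ^ 2 + 2 * (gamma * a - b) ^ 2)
    by (generalize (pow2_ge_0 (2 * gamma * a - b)); nra).
  apply (Rmult_le_compat_l m) in X; [|lra].
  assert (X1 : m * ((1 + 2 * gamma ^ 2) * a ^ 2) <= a1 * a ^ 2).
  { rewrite Ep, <- (Rmult_assoc m). apply Rmult_le_compat_r; [apply pow2_ge_0 | nra]. }
  assert (X2 : m * (2 * (gamma * a - b) ^ 2) <= beta * (gamma * a - b) ^ 2)
    by (generalize (pow2_ge_0 (gamma * a - b)); nra).
  assert (X3 : m * c ^ 2 <= rho * c ^ 2)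
    by (apply Rmult_le_compat_r; [apply pow2_ge_0 | lra]).
  assert (X4 : m * d ^ 2 <= mu * d ^ 2)
    by (apply Rmult_le_compat_r; [apply pow2_ge_0 | lra]).
  lra.
Qed.

Lemma quad_upper (rho mu alpha beta gamma : R) :
  0 < rho -> 0 < mu -> 0 < alpha -> 0 < beta -> 0 < gamma ->
  exists M, 0 < M /\ forall a b c d,
    quad rho mu alpha beta gamma a b c d <= M * (a ^ 2 + b ^ 2 + c ^ 2 + d ^ 2).
Proof.
  intros Hr Hm Ha Hb Hg. exists (rho + mu + alpha + beta + gamma * beta).
  assert (0 < gamma * beta) by nra. split; [lra|]. intros a b c d.
  unfold quad, alpha1.
  replace (rho * c ^ 2 + mu * d ^ 2 + beta * (gamma * a - b) ^ 2
      + (alpha - gamma ^ 2 * beta) * a ^ 2)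
    with (rho * c ^ 2 + mu * d ^ 2 + alpha * a ^ 2 + beta * b ^ 2
      + gamma * beta * (- 2 * a * b)) by ring.
  assert (X : gamma * beta * (- 2 * a * b) <= gamma * beta * (a ^ 2 + b ^ 2))
    by (apply Rmult_le_compat_l; [lra | generalize (pow2_ge_0 (a + b)); lra]).
  generalize (pow2_ge_0 a) (pow2_ge_0 b) (pow2_ge_0 c) (pow2_ge_0 d). intros.
  nra.
Qed.

(** Parallelogram identity: the two sides differ by half the form at the difference of the
    arguments, which is nonnegative by coercivity. *)
Lemma quad_mid (rho mu alpha beta gamma a b c d a' b' c' d' : R) :
  0 < rho -> 0 < mu -> 0 < beta -> 0 < alpha1 alpha beta gamma ->
  2 * quad rho mu alpha beta gamma
    ((a + a') / 2) ((b + b') / 2) ((c + c') / 2) ((d + d') / 2)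
  <= quad rho mu alpha beta gamma a b c d + quad rho mu alpha beta gamma a' b' c' d'.
Proof.
  intros Hr Hm Hb Ha.
  assert (E : quad rho mu alpha beta gamma a b c d
     + quad rho mu alpha beta gamma a' b' c' d'
     - 2 * quad rho mu alpha beta gamma
       ((a + a') / 2) ((b + b') / 2) ((c + c') / 2) ((d + d') / 2)
     = quad rho mu alpha beta gamma (a - a') (b - b') (c - c') (d - d') / 2)
    by (unfold quad; field).
  destruct (quad_lower rho mu alpha beta gamma Hr Hm Hb Ha) as [m [Pm H]].
  specialize (H (a - a') (b - b') (c - c') (d - d')).
  generalize (pow2_ge_0 (a - a')) (pow2_ge_0 (b - b'))
    (pow2_ge_0 (c - c')) (pow2_ge_0 (d - d')). intros. nra.
Qed.

(* Solving [S theta = p] with [S = ((alpha, - gamma beta), (- gamma beta, beta))],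
   whose determinant is [alpha1 beta]. *)
Lemma stress_inv (alpha beta gamma a b : R) :
  0 < beta -> 0 < alpha1 alpha beta gamma ->
  let p1 := alpha * a - gamma * beta * b in
  let p2 := beta * b - gamma * beta * a in
  a = (p1 + gamma * p2) / alpha1 alpha beta gamma /\ b = p2 / beta + gamma * a.
Proof.
  intros Hb Ha. unfold alpha1 in *. split; field; lra.
Qed.

(** Recovers strains from stresses: at [x = L] from the damping conditions, elsewhere from
    [S u_x = R w_t]. *)
Lemma stress_bound (alpha beta gamma : R) :
  0 < beta -> 0 < gamma -> 0 < alpha1 alpha beta gamma ->
  exists C, 0 < C /\ forall a b B,
    Rabs (alpha * a - gamma * beta * b) <= B ->
    Rabs (beta * b - gamma * beta * a) <= B ->
    Rabs a <= C * B /\ Rabs b <= C * B.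
Proof.
  intros Hb Hg Ha. set (a1 := alpha1 alpha beta gamma) in *.
  assert (P : 0 < (1 + gamma) / a1) by (apply Rdiv_lt_0_compat; lra).
  assert (Q : 0 < / beta) by now apply Rinv_0_lt_compat.
  exists ((1 + gamma) * ((1 + gamma) / a1) + / beta).
  split; [nra|]. intros a b B H1 H2.
  assert (HB : 0 <= B) by (eapply Rle_trans; [apply Rabs_pos | exact H1]).
  destruct (stress_inv alpha beta gamma a b Hb Ha) as [E1 E2]. fold a1 in E1.
  assert (X : Rabs a <= (1 + gamma) / a1 * B).
  { rewrite E1. unfold Rdiv. rewrite Rabs_mult, (Rabs_pos_eq (/ a1)).
    2: now apply Rlt_le, Rinv_0_lt_compat.
    replace ((1 + gamma) * / a1 * B) with ((B + gamma * B) * / a1) by ring.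
    apply Rmult_le_compat_r; [now apply Rlt_le, Rinv_0_lt_compat|].
    eapply Rle_trans; [apply Rabs_triang|]. rewrite Rabs_mult, (Rabs_pos_eq gamma) by lra.
    nra. }
  assert (Y : Rabs b <= / beta * B + gamma * ((1 + gamma) / a1 * B)).
  { rewrite E2. eapply Rle_trans; [apply Rabs_triang|].
    unfold Rdiv at 1. rewrite !Rabs_mult, (Rabs_pos_eq (/ beta)), (Rabs_pos_eq gamma) by lra.
    apply Rplus_le_compat; [rewrite Rmult_comm|]; apply Rmult_le_compat_l; lra. }
  assert (0 <= / beta * B) by nra.
  assert (0 <= (1 + gamma) / a1 * B) by nra.
  assert (0 <= gamma * ((1 + gamma) / a1 * B)) by nra.
  split; nra.
Qed.

(** At [x = L] the stress is [-(k1 c, k2 d)], so the velocities control the strains as well. The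
    multiplier produces a positive boundary term [q] at that end; this inequality lets the damping
    absorb it. *)
Lemma boundary_quad (rho mu alpha beta gamma k1 k2 : R) :
  0 < rho -> 0 < mu -> 0 < alpha -> 0 < beta -> 0 < gamma ->
  0 < alpha1 alpha beta gamma -> 0 < k1 -> 0 < k2 ->
  exists C, 0 < C /\ forall a b c d,
    alpha * a - gamma * beta * b = - k1 * c ->
    beta * b - gamma * beta * a = - k2 * d ->
    quad rho mu alpha beta gamma a b c d <= C * (k1 * c ^ 2 + k2 * d ^ 2).
Proof.
  intros Hr Hm Hal Hb Hg Ha Hk1 Hk2.
  destruct (quad_upper rho mu alpha beta gamma) as [M [HM UM]]; trivial.
  destruct (stress_bound alpha beta gamma Hb Hg Ha) as [C [HC SB]].
  set (K := k1 + k2). set (k := Rmin k1 k2).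
  assert (Hk : 0 < k) by now apply Rmin_pos.
  assert (k <= k1) by apply Rmin_l. assert (k <= k2) by apply Rmin_r.
  exists (M * (4 * (C * K) ^ 2 + 1) / k).
  assert (0 < (C * K) ^ 2) by (apply pow_lt; unfold K; nra).
  split. { apply Rdiv_lt_0_compat; [nra | exact Hk]. }
  intros a b c d E1 E2.
  destruct (SB a b (K * (Rabs c + Rabs d))) as [Xa Xb].
  { rewrite E1, Rabs_mult, Rabs_Ropp, Rabs_pos_eq by lra. unfold K.
    generalize (Rabs_pos c) (Rabs_pos d). nra. }
  { rewrite E2, Rabs_mult, Rabs_Ropp, Rabs_pos_eq by lra. unfold K.
    generalize (Rabs_pos c) (Rabs_pos d). nra. }
  assert (S : (Rabs c + Rabs d) ^ 2 <= 2 * (c ^ 2 + d ^ 2)).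
  { rewrite <- (pow2_abs c), <- (pow2_abs d).
    generalize (pow2_ge_0 (Rabs c - Rabs d)). nra. }
  assert (T : forall z, Rabs z <= C * (K * (Rabs c + Rabs d)) ->
     z ^ 2 <= 2 * (C * K) ^ 2 * (c ^ 2 + d ^ 2)).
  { intros z Hz. rewrite <- pow2_abs.
    apply Rle_trans with ((C * (K * (Rabs c + Rabs d))) ^ 2).
    - apply pow_incr. split; [apply Rabs_pos | exact Hz].
    - replace ((C * (K * (Rabs c + Rabs d))) ^ 2)
        with ((C * K) ^ 2 * (Rabs c + Rabs d) ^ 2) by ring. nra. }
  specialize (UM a b c d). generalize (T a Xa) (T b Xb). intros Ta Tb.
  apply Rle_trans with (M * (4 * (C * K) ^ 2 + 1) * (c ^ 2 + d ^ 2)); [nra|].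
  replace (M * (4 * (C * K) ^ 2 + 1) / k * (k1 * c ^ 2 + k2 * d ^ 2))
    with (M * (4 * (C * K) ^ 2 + 1) * ((k1 * c ^ 2 + k2 * d ^ 2) / k)) by (field; lra).
  apply Rmult_le_compat_l; [nra|].
  apply Rmult_le_reg_r with k; [exact Hk|].
  replace ((k1 * c ^ 2 + k2 * d ^ 2) / k * k) with (k1 * c ^ 2 + k2 * d ^ 2) by (field; lra).
  generalize (pow2_ge_0 c) (pow2_ge_0 d). nra.
Qed.

(** * Energy and multiplier balance on one cell *)

Definition flux (alpha beta gamma a b c d : R) : R :=
  c * (alpha * a - gamma * beta * b) + d * (beta * b - gamma * beta * a).

(** The work of the sources: the terms without [y] come from the energy, the last line from the
    multiplier, whose weight [eps (x + h/2)] is [y]. *)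
Definition source (rho mu alpha beta gamma y a b c d r1 r2 s1 s2 : R) : R :=
  c * s1 + d * s2
  + (alpha * a - gamma * beta * b) * r1 + (beta * b - gamma * beta * a) * r2
  + y * (rho * r1 * c + a * s1 + mu * r2 * d + b * s2).

(* The midpoint rule makes the product rule exact: mid f * delta g + mid g * delta f
   = delta (f g); hence the energy flux and the multiplier term telescope. *)
Lemma cell_identity (rho mu alpha beta gamma eps h x
    a b c d a' b' c' d' da db dc dd r1 r2 s1 s2 : R) :
  h <> 0 ->
  da - (c' - c) / h = r1 -> db - (d' - d) / h = r2 ->
  rho * dc - alpha * ((a' - a) / h) + gamma * beta * ((b' - b) / h) = s1 ->
  mu * dd - beta * ((b' - b) / h) + gamma * beta * ((a' - a) / h) = s2 ->
  let q := quad rho mu alpha beta gamma in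
  let A := (a + a') / 2 in let B := (b + b') / 2 in
  let C := (c + c') / 2 in let D := (d + d') / 2 in
  h * (C * (rho * dc) + D * (mu * dd)
       + (alpha * A - gamma * beta * B) * da + (beta * B - gamma * beta * A) * db
       + eps * (x + h / 2)
         * (rho * da * C + A * (rho * dc) + mu * db * D + B * (mu * dd)))
  = flux alpha beta gamma a' b' c' d' - flux alpha beta gamma a b c d
    + eps / 2 * ((x + h) * q a' b' c' d' - x * q a b c d)
    - eps / 4 * h * (q a b c d + q a' b' c' d')
    + h * source rho mu alpha beta gamma (eps * (x + h / 2)) A B C D r1 r2 s1 s2.
Proof.
  intros Hh E1 E2 E3 E4. cbv zeta.
  replace da with ((c' - c) / h + r1) by lra.
  replace db with ((d' - d) / h + r2) by lra.
  replace (rho * dc) with (alpha * ((a' - a) / h) - gamma * beta * ((b' - b) / h) + s1) by lra.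
  replace (mu * dd) with (beta * ((b' - b) / h) - gamma * beta * ((a' - a) / h) + s2) by lra.
  unfold flux, source, quad, alpha1. field. exact Hh.
Qed.

(** Young's inequality, once for each of the four variables: [k] dominates every coefficient, and
    the square of [2 kappa |z| - k sigma] is nonnegative. The four remainders
    [k^2 / (4 kappa) sigma^2] add up to [k^2 / kappa sigma^2]. *)
Lemma source_bound (rho mu alpha beta gamma Y : R) :
  0 < rho -> 0 < mu -> 0 < alpha -> 0 < beta -> 0 < gamma -> 0 < Y ->
  exists K, 0 < K /\ forall kappa sigma y a b c d r1 r2 s1 s2,
    0 < kappa -> 0 <= y <= Y ->
    Rabs r1 <= sigma -> Rabs r2 <= sigma -> Rabs s1 <= sigma -> Rabs s2 <= sigma ->
    source rho mu alpha beta gamma y a b c d r1 r2 s1 s2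
    <= kappa * (a ^ 2 + b ^ 2 + c ^ 2 + d ^ 2) + K / kappa * sigma ^ 2.
Proof.
  intros Hr Hm Ha Hb Hg HY. assert (Hgb : 0 < gamma * beta) by nra.
  set (k := 1 + alpha + beta + gamma * beta + Y * (1 + rho + mu)).
  assert (Yr : 0 < Y * rho) by nra. assert (Ym : 0 < Y * mu) by nra.
  assert (Hk : 0 < k) by (unfold k; lra).
  exists (k ^ 2). split; [now apply pow_lt|].
  intros kap sg y a b c d r1 r2 s1 s2 Hkap [Hy0 Hy] B1 B2 B3 B4.
  assert (Hs : 0 <= sg) by (eapply Rle_trans; [apply Rabs_pos | exact B1]).
  assert (P : forall p z s, 0 <= p -> Rabs s <= sg -> Rabs (p * (z * s)) <= p * (Rabs z * sg)).
  { intros p z s Hp Hz. rewrite !Rabs_mult, (Rabs_pos_eq p) by exact Hp.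
    apply Rmult_le_compat_l; [exact Hp|].
    apply Rmult_le_compat_l; [apply Rabs_pos | exact Hz]. }
  assert (Q : forall p z, p <= k -> p * (Rabs z * sg) <= kap * z ^ 2 + k ^ 2 / (4 * kap) * sg ^ 2).
  { intros p z Hp. apply Rle_trans with (k * (Rabs z * sg)).
    { apply Rmult_le_compat_r; [|exact Hp]. apply Rmult_le_pos; [apply Rabs_pos | exact Hs]. }
    assert (S : 0 <= (2 * kap * Rabs z - k * sg) ^ 2 / (4 * kap))
      by (apply Rdiv_le_0_compat; [apply pow2_ge_0 | lra]).
    rewrite <- (pow2_abs z).
    replace ((2 * kap * Rabs z - k * sg) ^ 2 / (4 * kap))
      with (kap * Rabs z ^ 2 + k ^ 2 / (4 * kap) * sg ^ 2 - k * (Rabs z * sg)) in S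
      by (field; lra). lra. }
  assert (yr : 0 <= y * rho <= Y * rho) by (split; nra).
  assert (ym : 0 <= y * mu <= Y * mu) by (split; nra).
  apply Rle_trans with ((alpha + gamma * beta + y) * (Rabs a * sg)
     + (gamma * beta + beta + y) * (Rabs b * sg)
     + (1 + y * rho) * (Rabs c * sg) + (1 + y * mu) * (Rabs d * sg)).
  - unfold source.
    generalize (P 1 c s1 Rle_0_1 B3) (P 1 d s2 Rle_0_1 B4)
     (P alpha a r1 (Rlt_le _ _ Ha) B1) (P (gamma * beta) b r1 (Rlt_le _ _ Hgb) B1)
     (P beta b r2 (Rlt_le _ _ Hb) B2) (P (gamma * beta) a r2 (Rlt_le _ _ Hgb) B2)
     (P (y * rho) c r1 (proj1 yr) B1) (P y a s1 Hy0 B3)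
     (P (y * mu) d r2 (proj1 ym) B2) (P y b s2 Hy0 B4).
    intros T1 T2 T3 T4 T5 T6 T7 T8 T9 T10.
    apply Rabs_le_between in T1, T2, T3, T4, T5, T6, T7, T8, T9, T10. lra.
  - replace (k ^ 2 / kap * sg ^ 2) with (4 * (k ^ 2 / (4 * kap) * sg ^ 2)) by (field; lra).
    generalize (Q (alpha + gamma * beta + y) a) (Q (gamma * beta + beta + y) b)
      (Q (1 + y * rho) c) (Q (1 + y * mu) d). unfold k at 1 3 5 7. 
    intros Q1 Q2 Q3 Q4. lra.
Qed.

(** The strain part of [quad] equals [alpha th1^2 - 2 gamma beta th1 th2 + beta th2^2], so half its
    gradient is the stress. The derivative is grouped accordingly, in the shape that [cell_identity]
    expects. *)
Lemma has_deriv_quad (D : R -> Prop) (rho mu alpha beta gamma x : R)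
    (f g p q : R -> R) (df dg dp dq : R) :
  has_deriv D f x df -> has_deriv D g x dg ->
  has_deriv D p x dp -> has_deriv D q x dq ->
  has_deriv D (fun y => quad rho mu alpha beta gamma (f y) (g y) (p y) (q y)) x
    (2 * (p x * (rho * dp) + q x * (mu * dq)
      + (alpha * f x - gamma * beta * g x) * df
      + (beta * g x - gamma * beta * f x) * dg)).
Proof.
  intros Hf Hg Hp Hq. unfold quad.
  set (z := fun y => gamma * f y - g y).
  assert (Hz : has_deriv D z x (gamma * df - dg)).
  { apply (has_deriv_minus D (fun y => gamma * f y) g); [|exact Hg].
    now apply has_deriv_scal. }
  assert (Sq : forall k e de, has_deriv D e x de ->
      has_deriv D (fun y => k * e y ^ 2) x (k * (2 * e x * de))).
  { intros k e de He. apply (has_deriv_scal D k (fun y => e y ^ 2)).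
    apply has_deriv_eq with (de * e x + e x * de); [ring|].
    (* [e y ^ 2] unfolds to [e y * (e y * 1)], and the product rule is applied in this shape. *)
    apply has_deriv_eq with (de * (e x * 1) + e x * (de * 1 + e x * 0)); [ring|].
    apply (has_deriv_mult D e (fun y => e y * 1)); [exact He|].
    apply (has_deriv_mult D e (fun y => 1)); [exact He | apply has_deriv_const]. }
  eapply has_deriv_eq;
    [|exact (has_deriv_plus D _ _ x _ _ (has_deriv_plus D _ _ x _ _
      (has_deriv_plus D _ _ x _ _ (Sq rho p dp Hp) (Sq mu q dq Hq))
      (Sq beta z _ Hz)) (Sq (alpha1 alpha beta gamma) f df Hf))].
  unfold z, alpha1. ring.
Qed.

(** * The Lyapunov functional and its decay *)

Lemma has_deriv_mid (D : R -> Prop) (U : nat -> R -> R) (j : nat) (t l m : R) :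
  has_deriv D (U j) t l -> has_deriv D (U (S j)) t m ->
  has_deriv D (mid U j) t ((l + m) / 2).
Proof. intros H1 H2. apply has_deriv_div. now apply has_deriv_plus. Qed.

Lemma has_deriv_Dt (f : R -> R) (t : R) :
  0 <= t -> derivable_in Ici f t -> has_deriv Ici f t (Dt f t).
Proof. intros Ht. apply has_deriv_Derive_in. now apply adhDa_Ici. Qed.

Lemma Dt_eq (f : R -> R) (t l : R) : 0 <= t -> has_deriv Ici f t l -> Dt f t = l.
Proof. intros Ht. apply Derive_in_unique. now apply adhDa_Ici. Qed.

Lemma has_deriv_mid_Dt (U : nat -> R -> R) (j : nat) (t : R) :
  0 <= t -> derivable_in Ici (U j) t -> derivable_in Ici (U (S j)) t ->
  has_deriv Ici (mid U j) t (Dt (mid U j) t).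
Proof.
  intros Ht H1 H2. apply has_deriv_Dt; [exact Ht|].
  eexists. apply has_deriv_mid; apply has_deriv_Dt; eassumption.
Qed.

(* Lyapunov functional: the energy plus [eps] times the discrete analogue of
   the multiplier [int x (rho theta1 eta1 + mu theta2 eta2) dx]. *)
Definition lyap_cell (L rho mu alpha beta gamma eps : R) (N : nat)
    (th1 th2 et1 et2 : nat -> R -> R) (j : nat) (t : R) : R :=
  mesh L N * (/ 2 * quad rho mu alpha beta gamma
      (mid th1 j t) (mid th2 j t) (mid et1 j t) (mid et2 j t)
    + eps * (node L N j + mesh L N / 2)
      * (rho * (mid th1 j t * mid et1 j t) + mu * (mid th2 j t * mid et2 j t))).

(** By [quad_mid] the nodal dissipation in [cell_identity] is at least [eps/2 h q] at the midpoint.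
    Half of it absorbs the quadratic part of the sources, whence the weight [eps m / 4] in Young's
    inequality; the other half remains. The condition [eps <= 1] keeps the multiplier weight below
    [L]. *)
Lemma cell_dissipation (rho mu alpha beta gamma L : R) :
  0 < rho -> 0 < mu -> 0 < alpha -> 0 < beta -> 0 < gamma ->
  0 < alpha1 alpha beta gamma -> 0 < L ->
  forall eps, 0 < eps <= 1 ->
  exists K, 0 < K /\ forall h x sigma
    a b c d a' b' c' d' da db dc dd r1 r2 s1 s2,
  0 < h -> 0 <= x -> x + h <= L ->
  Rabs r1 <= sigma -> Rabs r2 <= sigma -> Rabs s1 <= sigma -> Rabs s2 <= sigma ->
  da - (c' - c) / h = r1 -> db - (d' - d) / h = r2 ->
  rho * dc - alpha * ((a' - a) / h) + gamma * beta * ((b' - b) / h) = s1 ->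
  mu * dd - beta * ((b' - b) / h) + gamma * beta * ((a' - a) / h) = s2 ->
  let q := quad rho mu alpha beta gamma in
  let A := (a + a') / 2 in let B := (b + b') / 2 in
  let C := (c + c') / 2 in let D := (d + d') / 2 in
  h * (C * (rho * dc) + D * (mu * dd)
       + (alpha * A - gamma * beta * B) * da + (beta * B - gamma * beta * A) * db
       + eps * (x + h / 2)
         * (rho * da * C + A * (rho * dc) + mu * db * D + B * (mu * dd)))
  <= flux alpha beta gamma a' b' c' d' - flux alpha beta gamma a b c d
    + eps / 2 * ((x + h) * q a' b' c' d' - x * q a b c d)
    - eps / 4 * (h * q A B C D) + h * (K * sigma ^ 2).
Proof.
  intros Hr Hm Hal Hb Hg Ha HL eps [He He1].
  destruct (quad_lower rho mu alpha beta gamma Hr Hm Hb Ha) as [m [Pm Lm]].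
  destruct (source_bound rho mu alpha beta gamma L Hr Hm Hal Hb Hg HL) as [K [HK SB]].
  assert (Hkap : 0 < eps * m / 4) by nra.
  exists (K / (eps * m / 4)). split; [now apply Rdiv_lt_0_compat|].
  intros h x sg a b c d a' b' c' d' da db dc dd r1 r2 s1 s2 Hh Hx HxL R1 R2 R3 R4
    E1 E2 E3 E4 q A B C D.
  generalize (cell_identity rho mu alpha beta gamma eps h x a b c d a' b' c' d'
    da db dc dd r1 r2 s1 s2 (Rgt_not_eq _ _ Hh) E1 E2 E3 E4). cbv zeta.
  fold q A B C D. intros ->.
  generalize (quad_mid rho mu alpha beta gamma a b c d a' b' c' d' Hr Hm Hb Ha).
  fold q A B C D. intros Cv.
  assert (Hy : 0 <= eps * (x + h / 2) <= L) by (split; nra).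
  generalize (SB (eps * m / 4) sg (eps * (x + h / 2)) A B C D r1 r2 s1 s2 Hkap Hy R1 R2 R3 R4).
  intros S. generalize (Lm A B C D). fold q. intros Lq.
  assert (S' : source rho mu alpha beta gamma (eps * (x + h / 2)) A B C D r1 r2 s1 s2
     <= eps / 4 * q A B C D + K / (eps * m / 4) * sg ^ 2) by nra.
  apply (Rmult_le_compat_l h) in S'; [|lra].
  apply (Rmult_le_compat_l (eps / 4 * h)) in Cv; [|nra].
  lra.
Qed.

Definition lyap_rate (rho mu alpha beta gamma eps h x A B C D da db dc dd : R) : R :=
  h * (C * (rho * dc) + D * (mu * dd)
       + (alpha * A - gamma * beta * B) * da + (beta * B - gamma * beta * A) * db
       + eps * (x + h / 2)
         * (rho * da * C + A * (rho * dc) + mu * db * D + B * (mu * dd))).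

Lemma has_deriv_lyap_cell (L rho mu alpha beta gamma eps : R) (N : nat)
    (u1 u2 w1 w2 : nat -> R -> R) (j : nat) (t da db dc dd : R) :
  has_deriv Ici (mid u1 j) t da -> has_deriv Ici (mid u2 j) t db ->
  has_deriv Ici (mid w1 j) t dc -> has_deriv Ici (mid w2 j) t dd ->
  has_deriv Ici (lyap_cell L rho mu alpha beta gamma eps N u1 u2 w1 w2 j) t
    (lyap_rate rho mu alpha beta gamma eps (mesh L N) (node L N j)
       (mid u1 j t) (mid u2 j t) (mid w1 j t) (mid w2 j t) da db dc dd).
Proof.
  intros H1 H2 H3 H4. unfold lyap_rate.
  apply (has_deriv_scal Ici (mesh L N) (fun t =>
    / 2 * quad rho mu alpha beta gamma (mid u1 j t) (mid u2 j t) (mid w1 j t) (mid w2 j t)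
    + eps * (node L N j + mesh L N / 2)
      * (rho * (mid u1 j t * mid w1 j t) + mu * (mid u2 j t * mid w2 j t)))).
  eapply has_deriv_eq; [|apply has_deriv_plus].
  2: { apply has_deriv_scal. apply has_deriv_quad; eassumption. }
  2: { apply has_deriv_scal. apply has_deriv_plus; apply has_deriv_scal.
       - exact (has_deriv_mult _ _ _ _ _ _ H1 H3).
       - exact (has_deriv_mult _ _ _ _ _ _ H2 H4). }
  cbv beta. field.
Qed.

(** The products in the multiplier are at most [(rho + mu)] times the sum of squares and the weight
    is at most [eps L], so by the smallness of [eps] the multiplier changes [q / 2] by at most
    [q / 4]. *)
Lemma lyap_cell_equiv (L rho mu alpha beta gamma eps m : R) :
  0 < L -> 0 < rho -> 0 < mu -> 0 < eps ->
  (forall a b c d,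
    m * (a ^ 2 + b ^ 2 + c ^ 2 + d ^ 2) <= quad rho mu alpha beta gamma a b c d) ->
  4 * (eps * (L * (rho + mu))) <= m ->
  forall (N : nat) (u1 u2 w1 w2 : nat -> R -> R) (j : nat) (t : R), (j <= N)%nat ->
  let Q := mesh L N * quad rho mu alpha beta gamma
             (mid u1 j t) (mid u2 j t) (mid w1 j t) (mid w2 j t) in
  Q / 4 <= lyap_cell L rho mu alpha beta gamma eps N u1 u2 w1 w2 j t <= Q.
Proof.
  intros HL Hr Hm He Lm Hsmall N u1 u2 w1 w2 j t Hj.
  unfold lyap_cell. cbv zeta.
  set (a := mid u1 j t). set (b := mid u2 j t).
  set (c := mid w1 j t). set (d := mid w2 j t).
  specialize (Lm a b c d). set (q := quad _ _ _ _ _ _ _ _ _) in *.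
  set (h := mesh L N). assert (Hh : 0 < h) by now apply mesh_pos.
  assert (Hy : 0 <= node L N j + h / 2 <= L).
  { generalize (node_range L N j HL ltac:(lia)) (node_range L N (S j) HL ltac:(lia)).
    rewrite node_succ. unfold Icc. fold h. lra. }
  set (y := node L N j + h / 2) in *. clearbody y.
  set (n := a ^ 2 + b ^ 2 + c ^ 2 + d ^ 2) in *.
  assert (N1 : forall z v, - (z ^ 2 + v ^ 2) <= 2 * (z * v) <= z ^ 2 + v ^ 2).
  { intros z v. generalize (pow2_ge_0 (z + v)) (pow2_ge_0 (z - v)). lra. }
  generalize (pow2_ge_0 a) (pow2_ge_0 b) (pow2_ge_0 c) (pow2_ge_0 d).
  intros Sa Sb Sc Sd.
  assert (Hn : 0 <= n) by (unfold n; lra).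
  assert (P : - ((rho + mu) * n) <= rho * (a * c) + mu * (b * d) <= (rho + mu) * n).
  { generalize (N1 a c) (N1 b d). intros X Y. unfold n. split; nra. }
  set (p := rho * (a * c) + mu * (b * d)) in *.
  assert (Z : eps * y * ((rho + mu) * n) <= q / 4).
  { apply Rle_trans with (m * n / 4); [|lra].
    apply Rle_trans with (eps * (L * (rho + mu)) * n); [|nra].
    replace (eps * y * ((rho + mu) * n)) with ((eps * (rho + mu) * n) * y) by ring.
    replace (eps * (L * (rho + mu)) * n) with ((eps * (rho + mu) * n) * L) by ring.
    apply Rmult_le_compat_l; [|lra]. apply Rmult_le_pos; [nra | exact Hn]. }
  assert (Hey : 0 <= eps * y) by nra.
  assert (W : - (q / 4) <= eps * y * p <= q / 4) by (split; nra).
  split; [replace (h * q / 4) with (h * (q / 4)) by field|];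
    apply Rmult_le_compat_l; lra.
Qed.

(** [K] is fixed before the mesh, the time and the data, and the sources are arbitrary; so the
    estimate covers both the error system and difference quotients of exact solutions on an
    auxiliary mesh. *)
Lemma scheme_stable (L rho mu alpha beta gamma k1 k2 : R) :
  0 < L -> 0 < rho -> 0 < mu -> 0 < alpha -> 0 < beta -> 0 < gamma ->
  0 < alpha1 alpha beta gamma -> 0 < k1 -> 0 < k2 ->
  exists K, 0 < K /\
  forall (N : nat) (r1 r2 s1 s2 : nat -> R -> R) (a1 a2 b1 b2 : nat -> R)
    (u1 u2 w1 w2 : nat -> R -> R) (T sigma : R),
  0 <= T ->
  scheme L rho mu alpha beta gamma k1 k2 N r1 r2 s1 s2 a1 a2 b1 b2 u1 u2 w1 w2 ->
  (forall j t, (j <= N)%nat -> 0 <= t <= T ->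
     Rabs (r1 j t) <= sigma /\ Rabs (r2 j t) <= sigma /\
     Rabs (s1 j t) <= sigma /\ Rabs (s2 j t) <= sigma) ->
  let e := energy L rho mu alpha beta gamma N u1 u2 w1 w2 in
  e T <= K * (e 0 + sigma ^ 2).
Proof.
  intros HL Hr Hm Hal Hb Hg Ha Hk1 Hk2.
  destruct (quad_lower rho mu alpha beta gamma Hr Hm Hb Ha) as [m [Pm Lm]].
  destruct (boundary_quad rho mu alpha beta gamma k1 k2 Hr Hm Hal Hb Hg Ha Hk1 Hk2)
    as [Cq [HCq BQ]].
  assert (P1 : 0 < 4 * (L * (rho + mu))) by nra.
  assert (P2 : 0 < L * Cq) by nra.
  (* The three bounds serve, in this order, the multiplier weight, the equivalence with the energy,
     and the absorption of the boundary term at [x = L]. *)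
  set (eps := Rmin 1 (Rmin (m / (4 * (L * (rho + mu)))) (1 / (L * Cq)))).
  assert (He : 0 < eps).
  { unfold eps. repeat apply Rmin_pos; try apply Rdiv_lt_0_compat; lra. }
  assert (He1 : eps <= 1) by apply Rmin_l.
  assert (Em : 4 * (eps * (L * (rho + mu))) <= m).
  { assert (X : eps <= m / (4 * (L * (rho + mu))))
      by (eapply Rle_trans; [apply Rmin_r | apply Rmin_l]).
    apply (Rmult_le_compat_r (4 * (L * (rho + mu)))) in X; [|lra].
    replace (m / (4 * (L * (rho + mu))) * (4 * (L * (rho + mu)))) with m in X
      by (field; repeat split; lra). lra. }
  assert (EC : eps * L * Cq <= 1).
  { assert (X : eps <= 1 / (L * Cq)) by (eapply Rle_trans; apply Rmin_r).
    apply (Rmult_le_compat_r (L * Cq)) in X; [|lra].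
    replace (1 / (L * Cq) * (L * Cq)) with 1 in X by (field; lra). lra. }
  destruct (cell_dissipation rho mu alpha beta gamma L Hr Hm Hal Hb Hg Ha HL eps
    (conj He He1)) as [K [HK CD]].
  assert (HK8 : 0 < 8 * L * K / eps) by (apply Rdiv_lt_0_compat; nra).
  (* Since [e/2 <= F <= 2 e], passing from [F] back to [e] turns the bound
     [F 0 + L K sigma^2 / (eps/4)] into [4 e(0) + 8 L K sigma^2 / eps]. *)
  exists (4 + 8 * L * K / eps). split; [lra|].
  intros N r1 r2 s1 s2 a1 a2 b1 b2 u1 u2 w1 w2 T sg HT [Hd [Hs [Hbc _]]] Hsrc e.
  set (q := fun j t => quad rho mu alpha beta gamma
             (mid u1 j t) (mid u2 j t) (mid w1 j t) (mid w2 j t)).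
  set (F := fun t => sum_f_R0 (fun j => lyap_cell L rho mu alpha beta gamma eps N
                                          u1 u2 w1 w2 j t) N).
  set (dF := fun t => sum_f_R0 (fun j => lyap_rate rho mu alpha beta gamma eps
       (mesh L N) (node L N j) (mid u1 j t) (mid u2 j t) (mid w1 j t) (mid w2 j t)
       (Dt (mid u1 j) t) (Dt (mid u2 j) t) (Dt (mid w1 j) t) (Dt (mid w2 j) t)) N).
  assert (Ee : forall t, 2 * e t = sum_f_R0 (fun j => mesh L N * q j t) N).
  { intros t. unfold e. rewrite energy_quad.
    replace (2 * (mesh L N / 2 * _)) with (mesh L N * sum_f_R0 (fun j => q j t) N)
      by (unfold q; field).
    rewrite scal_sum. apply sum_eq. intros j _. ring. }
  assert (FE : forall t, e t / 2 <= F t <= 2 * e t).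
  { intros t. rewrite Ee. split.
    - replace (e t / 2) with (2 * e t * / 4) by field.
      rewrite Ee, Rmult_comm, scal_sum. apply sum_Rle. intros j Hj.
      apply (lyap_cell_equiv L rho mu alpha beta gamma eps m HL Hr Hm He Lm Em
        N u1 u2 w1 w2 j t Hj).
    - apply sum_Rle. intros j Hj.
      apply (lyap_cell_equiv L rho mu alpha beta gamma eps m HL Hr Hm He Lm Em
        N u1 u2 w1 w2 j t Hj). }
  assert (Epos : forall t, 0 <= e t).
  { intros t. generalize (FE t). lra. }
  (* The cells leave the dissipation [-(eps/4) * 2 e], which is at most [-(eps/4) F]; hence a decay
     rate that does not see the mesh. *)
  assert (G : F T <= F 0 + L * (K * sg ^ 2) / (eps / 4)).
  { apply gronwall with dF.
    - lra.
    - generalize (pow2_ge_0 sg). intros. apply Rmult_le_pos; nra.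
    - generalize (FE 0) (Epos 0). lra.
    - exact HT.
    - intros t Ht. apply has_deriv_sum. intros j Hj.
      destruct (Hd j t ltac:(lia) ltac:(lra)) as [D1 [D2 [D3 D4]]].
      destruct (Hd (S j) t ltac:(lia) ltac:(lra)) as [D1' [D2' [D3' D4']]].
      apply has_deriv_lyap_cell; apply has_deriv_mid_Dt; (lra || assumption).
    - intros t Ht.
      set (fl := fun j => flux alpha beta gamma (u1 j t) (u2 j t) (w1 j t) (w2 j t)).
      set (xq := fun j => node L N j
         * quad rho mu alpha beta gamma (u1 j t) (u2 j t) (w1 j t) (w2 j t)).
      assert (B : dF t <= sum_f_R0 (fun j => (fl (S j) - fl j)) N
         + sum_f_R0 (fun j => (xq (S j) - xq j)) N * (eps / 2)
         + sum_f_R0 (fun j => mesh L N * q j t) N * (- (eps / 4))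
         + sum_f_R0 (fun j => mesh L N * (K * sg ^ 2)) N).
      { rewrite (Rmult_comm (sum_f_R0 (fun j => xq (S j) - xq j) N)),
          (Rmult_comm (sum_f_R0 (fun j => mesh L N * q j t) N)), !scal_sum, <- !sum_plus.
        apply sum_Rle. intros j Hj.
        destruct (Hs j t Hj ltac:(lra)) as [S1 [S2 [S3 S4]]].
        destruct (Hsrc j t Hj Ht) as [B1 [B2 [B3 B4]]].
        assert (Hh : 0 < mesh L N) by now apply mesh_pos.
        destruct (node_range L N j HL ltac:(lia)) as [X0 _].
        destruct (node_range L N (S j) HL ltac:(lia)) as [_ X1].
        rewrite node_succ in X1.
        eapply Rle_trans; [exact (CD _ _ sg _ _ _ _ _ _ _ _ _ _ _ _ _ _ _ _ Hh X0 X1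
          B1 B2 B3 B4 S1 S2 S3 S4)|].
        unfold fl, xq, q. rewrite node_succ. unfold mid. lra. }
      rewrite !sum_f_R0_telescope, sum_mesh, <- Ee in B.
      destruct (Hbc t ltac:(lra)) as [Z1 [Z2 [Y1 Y2]]].
      rewrite Nat.add_1_r in Y1, Y2.
      (* Boundary terms after telescoping: at the left end the weight and the velocities vanish; at
         the right end the flux is [- kk], and it outweighs the multiplier term, which is at most
         [(eps/2) L Cq kk]. *)
      assert (X0 : xq 0%nat = 0) by (unfold xq, node; simpl; ring).
      assert (FL0 : fl 0%nat = 0) by (unfold fl, flux; rewrite Z1, Z2; ring).
      specialize (BQ _ _ _ _ Y1 Y2).
      set (kk := k1 * w1 (S N) t ^ 2 + k2 * w2 (S N) t ^ 2) in *.
      assert (FL1 : fl (S N) = - kk) by (unfold fl, flux, kk; rewrite Y1, Y2; ring).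
      assert (Hkk : 0 <= kk).
      { unfold kk. generalize (pow2_ge_0 (w1 (S N) t)) (pow2_ge_0 (w2 (S N) t)). nra. }
      assert (X1 : xq (S N) <= L * (Cq * kk)).
      { unfold xq, node. rewrite <- Nat.add_1_r, mesh_mult, Nat.add_1_r.
        apply Rmult_le_compat_l; lra. }
      rewrite X0, FL0, FL1 in B.
      assert (X2 : xq (S N) * (eps / 2) <= kk).
      { apply Rle_trans with (L * (Cq * kk) * (eps / 2)); nra. }
      generalize (FE t). intros [_ F2]. nra. }
  generalize (FE T) (FE 0) (Epos 0) (pow2_ge_0 sg). intros [F1 _] [_ F2] E0 Sg.
  assert (X : e T <= 4 * e 0 + 8 * L * K / eps * sg ^ 2).
  { replace (8 * L * K / eps * sg ^ 2) with (2 * (L * (K * sg ^ 2) / (eps / 4)))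
      by (field; lra). lra. }
  nra.
Qed.

(** * Uniform-in-time bounds for classical solutions *)

Lemma mesh_small (L d : R) : 0 < L -> 0 < d -> exists N, mesh L N < d.
Proof.
  intros HL Hd. destruct (archimed_cor1 (d / L)) as [N [HN HN0]].
  { now apply Rdiv_lt_0_compat. }
  exists N. unfold mesh.
  apply (Rmult_lt_compat_l L) in HN; [|exact HL].
  replace (L * (d / L)) with d in HN by (field; lra).
  apply Rlt_trans with (2 := HN). apply Rmult_lt_compat_l; [exact HL|].
  apply lt_0_INR in HN0 as P. rewrite plus_INR. simpl.
  apply Rinv_lt_contravar; nra.
Qed.

(** * Joint continuity and elementary mean value estimates *)

Definition jcont (L : R) (g : R -> R -> R) : Prop :=
  forall x t, Icc L x -> 0 <= t -> forall e, 0 < e -> exists d, 0 < d /\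
    forall y s, Icc L y -> 0 <= s -> Rabs (y - x) < d -> Rabs (s - t) < d ->
      Rabs (g y s - g x t) < e.

Lemma jcont_plus (L : R) (f g : R -> R -> R) :
  jcont L f -> jcont L g -> jcont L (fun x t => f x t + g x t).
Proof.
  intros Hf Hg x t Hx Ht e He.
  destruct (Hf x t Hx Ht (e / 2)) as [a [Ha Ka]]; [lra|].
  destruct (Hg x t Hx Ht (e / 2)) as [b [Hb Kb]]; [lra|].
  exists (Rmin a b). split; [now apply Rmin_pos|]. intros y s Hy Hs H1 H2.
  generalize (Rmin_l a b) (Rmin_r a b). intros.
  specialize (Ka y s Hy Hs ltac:(lra) ltac:(lra)).
  specialize (Kb y s Hy Hs ltac:(lra) ltac:(lra)).
  replace (f y s + g y s - (f x t + g x t)) with ((f y s - f x t) + (g y s - g x t)) by ring.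
  eapply Rle_lt_trans; [apply Rabs_triang | lra].
Qed.

Lemma jcont_scal (L c : R) (f : R -> R -> R) :
  jcont L f -> jcont L (fun x t => c * f x t).
Proof.
  intros Hf x t Hx Ht e He.
  assert (P : 0 < Rabs c + 1) by (generalize (Rabs_pos c); lra).
  destruct (Hf x t Hx Ht (e / (Rabs c + 1))) as [a [Ha Ka]].
  { now apply Rdiv_lt_0_compat. }
  exists a. split; [exact Ha|]. intros y s Hy Hs H1 H2.
  specialize (Ka y s Hy Hs H1 H2).
  rewrite <- Rmult_minus_distr_l, Rabs_mult.
  apply (Rmult_lt_compat_l (Rabs c + 1)) in Ka; [|exact P].
  replace ((Rabs c + 1) * (e / (Rabs c + 1))) with e in Ka by (field; lra).
  generalize (Rabs_pos (f y s - f x t)). lra.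
Qed.

Lemma jcont_uniform (L T : R) (g : R -> R -> R) :
  0 < L -> 0 <= T -> jcont L g -> forall e, 0 < e -> exists d, 0 < d /\
    forall x y t s, Icc L x -> Icc L y -> 0 <= t <= T -> 0 <= s <= T ->
      Rabs (y - x) < d -> Rabs (s - t) < d -> Rabs (g y s - g x t) < e.
Proof.
  intros HL HT Hg e He.
  destruct (uniform_continuity_2d (fun x t => g (clamp 0 L x) (clamp 0 T t)) 0 L 0 T)
    with (eps := mkposreal e He) as [d Hd].
  - intros x t Hx Ht eps.
    destruct (Hg (clamp 0 L x) (clamp 0 T t)
      (clamp_range 0 L x (Rlt_le _ _ HL)) (proj1 (clamp_range 0 T t HT))
      eps (cond_pos eps)) as [d [Hd K]].
    exists (mkposreal d Hd). simpl. intros y s Hy Hs. apply K.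
    + apply (clamp_range 0 L y). lra.
    + apply (clamp_range 0 T s HT).
    + eapply Rle_lt_trans; [apply clamp_lipschitz | exact Hy].
    + eapply Rle_lt_trans; [apply clamp_lipschitz | exact Hs].
  - exists d. split; [apply cond_pos|]. intros x y t s Hx Hy Ht Hs H1 H2.
    specialize (Hd x t y s Hx Ht Hy Hs H1 H2). simpl in Hd.
    now rewrite !clamp_id in Hd.
Qed.

Lemma jcont_bounded (L t : R) (g : R -> R -> R) :
  0 < L -> 0 <= t -> jcont L g -> exists B, 0 <= B /\ forall x, Icc L x -> Rabs (g x t) <= B.
Proof.
  intros HL Ht Hg.
  destruct (continuity_ab_maj (fun x => Rabs (g (clamp 0 L x) t)) 0 L) as [M [HM _]].
  - lra.
  - intros x _. apply (continuity_pt_clamp (Icc L) (fun x => Rabs (g x t)));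
      [lra | trivial |].
    intros y Hy e He. destruct (Hg y t Hy Ht e He) as [d [Hd K]].
    exists d. split; [exact Hd|]. intros z Hz H.
    eapply Rle_lt_trans; [apply Rabs_triang_inv2|]. apply K; trivial.
    now rewrite Rminus_diag, Rabs_R0.
  - exists (Rabs (g (clamp 0 L M) t)). split; [apply Rabs_pos|].
    intros x Hx. specialize (HM x Hx). now rewrite (clamp_id 0 L x) in HM.
Qed.

Lemma has_deriv_shift (f : R -> R) (s t l : R) :
  0 <= s -> has_deriv Ici f (t + s) l -> has_deriv Ici (fun y => f (y + s)) t l.
Proof.
  intros Hs H e He. destruct (H e He) as [a [Ha K]].
  exists a. split; [exact Ha|]. intros y [[Dy N] Hy]. unfold Ici in *.
  replace (y - t) with (y + s - (t + s)) by ring. apply K. repeat split.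
  - unfold Ici. lra.
  - lra.
  - simpl in *. unfold Rdist in *. now replace (y + s - (t + s)) with (y - t) by ring.
Qed.

(** The difference quotient is a value [g c] with [a <= c <= b], and both end points are within
    [b - a] of [c]; the oscillation of [g] is all that enters. *)
Lemma midpoint_quotient (L : R) (f g : R -> R) (a b e : R) :
  Icc L a -> Icc L b -> a < b ->
  (forall x, Icc L x -> has_deriv (Icc L) f x (g x)) ->
  (forall x y, Icc L x -> Icc L y -> Rabs (y - x) <= b - a -> Rabs (g y - g x) <= e) ->
  Rabs ((g a + g b) / 2 - (f b - f a) / (b - a)) <= e.
Proof.
  unfold Icc. intros Ha Hb Hab Hf Hg.
  destruct (MVT_in (Icc L) f g a b) as [c [Hc E]]; [exact Hab | unfold Icc; intros; lra | |].
  - intros x Hx. apply Hf. lra.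
  - replace ((f b - f a) / (b - a)) with (g c) by (rewrite E; field; lra).
    assert (Hc' : 0 <= c <= L) by lra.
    assert (X1 := Hg c a Hc' Ha). assert (X2 := Hg c b Hc' Hb).
    rewrite Rabs_left1 in X1 at 1 by lra. rewrite Rabs_pos_eq in X2 at 1 by lra.
    specialize (X1 ltac:(lra)). specialize (X2 ltac:(lra)).
    replace ((g a + g b) / 2 - g c) with (((g a - g c) + (g b - g c)) / 2) by field.
    unfold Rdiv. rewrite Rabs_mult, (Rabs_pos_eq (/ 2)) by lra.
    generalize (Rabs_triang (g a - g c) (g b - g c)). lra.
Qed.

(** Discrete form of the bound of [f - f(0)] by the [L^1] norm of the derivative. On each cell [g]
    stays within 1 of its end point average, which costs [h] per cell and [L] in total. *)
Lemma increment_bound (L : R) (N : nat) (f g : R -> R) (C : R) :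
  0 < L ->
  (forall x, Icc L x -> has_deriv (Icc L) f x (g x)) ->
  (forall x y, Icc L x -> Icc L y -> Rabs (y - x) <= mesh L N -> Rabs (g y - g x) <= 1) ->
  sum_f_R0 (fun j => mesh L N * Rabs ((g (node L N j) + g (node L N (S j))) / 2)) N <= C ->
  forall x, Icc L x -> Rabs (f x - f 0) <= C + L.
Proof.
  intros HL Hf Hg HC. set (h := mesh L N) in *.
  assert (Hh : 0 < h) by now apply mesh_pos.
  set (m := fun j => Rabs ((g (node L N j) + g (node L N (S j))) / 2)).
  change (sum_f_R0 (fun j => h * m j) N <= C) in HC.
  assert (Cell : forall j x, (j <= N)%nat -> node L N j <= x <= node L N (S j) ->
     Rabs (f x - f (node L N j)) <= h * m j + h * 1).
  { intros j x Hj Hx.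
    destruct (node_range L N j HL ltac:(lia)) as [A0 A1].
    destruct (node_range L N (S j) HL ltac:(lia)) as [B0 B1].
    rewrite node_succ in *. fold h in Hx, B0, B1.
    destruct (Req_dec (node L N j) x) as [<-|Nx].
    { rewrite Rminus_diag, Rabs_R0. generalize (Rabs_pos ((g (node L N j) + g (node L N (S j))) / 2)).
      fold (m j). nra. }
    destruct (MVT_in (Icc L) f g (node L N j) x) as [c [Hc E]];
      [lra | unfold Icc; intros; lra | intros; apply Hf; unfold Icc; lra |].
    rewrite E, Rabs_mult, (Rabs_pos_eq (x - node L N j)) by lra.
    apply Rle_trans with ((m j + 1) * h); [|lra].
    apply Rmult_le_compat; [apply Rabs_pos | lra | | lra].
    assert (X1 := Hg c (node L N j) ltac:(unfold Icc; lra) ltac:(unfold Icc; lra)).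
    assert (X2 := Hg c (node L N (S j)) ltac:(unfold Icc; lra)
      ltac:(rewrite node_succ; fold h; unfold Icc; lra)).
    rewrite Rabs_left1 in X1 at 1 by lra.
    rewrite Rabs_pos_eq in X2 at 1 by (rewrite node_succ; fold h; lra).
    specialize (X1 ltac:(lra)). specialize (X2 ltac:(rewrite node_succ; fold h; lra)).
    unfold m. apply Rabs_le_between in X1, X2.
    set (u := (g (node L N j) + g (node L N (S j))) / 2).
    assert (-1 <= g c - u <= 1) by (unfold u; lra).
    replace (g c) with (u + (g c - u)) by ring.
    eapply Rle_trans; [apply Rabs_triang|]. apply Rplus_le_compat_l, Rabs_le. lra. }
  assert (mpos : forall j, 0 <= m j) by (intros; apply Rabs_pos).
  assert (Ind : forall n x, (n <= N)%nat -> 0 <= x <= node L N (S n) ->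
     Rabs (f x - f 0) <= sum_f_R0 (fun j => h * m j + h * 1) n).
  { induction n as [|n IH]; intros x Hn Hx.
    - simpl. replace 0 with (node L N 0) by (unfold node; simpl; ring).
      apply Cell; [lia|]. unfold node at 1. simpl. lra.
    - rewrite tech5. destruct (Rle_dec x (node L N (S n))) as [Hl|Hl].
      + generalize (IH x ltac:(lia) ltac:(lra)) (mpos (S n)). nra.
      + generalize (Cell (S n) x Hn ltac:(lra)).
        generalize (IH (node L N (S n)) ltac:(lia)
          ltac:(split; [apply node_range; [exact HL | lia] | lra])).
        intros X Y. replace (f x - f 0)
          with ((f (node L N (S n)) - f 0) + (f x - f (node L N (S n)))) by ring.
        eapply Rle_trans; [apply Rabs_triang | lra]. }
  intros x Hx. eapply Rle_trans.
  - apply (Ind N x); [lia|]. unfold node. rewrite <- Nat.add_1_r, mesh_mult. exact Hx.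
  - rewrite sum_plus. generalize (sum_mesh L 1 N). fold h. lra.
Qed.

(** * Difference quotients in time as solutions of the scheme *)

Definition dquot (s : R) (f : R -> R -> R) (x t : R) : R := (f x (t + s) - f x t) / s.

Lemma has_deriv_dquot_t (s : R) (f g : R -> R -> R) (x t : R) :
  0 <= s -> 0 <= t ->
  (forall t, 0 <= t -> has_deriv Ici (f x) t (g x t)) ->
  has_deriv Ici (dquot s f x) t (dquot s g x t).
Proof.
  intros Hs Ht Hf. apply has_deriv_div. apply has_deriv_minus; [|now apply Hf].
  apply has_deriv_shift; [exact Hs|]. apply Hf. lra.
Qed.

Lemma dquot_near (s : R) (f g : R -> R -> R) (x t e : R) :
  0 < s -> 0 <= t ->
  (forall t, 0 <= t -> has_deriv Ici (f x) t (g x t)) ->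
  (forall r, t <= r <= t + s -> Rabs (g x r - g x t) <= e) ->
  Rabs (dquot s f x t - g x t) <= e.
Proof.
  intros Hs Ht Hf Hg.
  destruct (MVT_in Ici (f x) (g x) t (t + s)) as [c [Hc E]];
    [lra | unfold Ici; intros; lra | intros; apply Hf; lra |].
  unfold dquot. rewrite E. replace (g x c * (t + s - t) / s) with (g x c) by (field; lra).
  now apply Hg.
Qed.

(** At each of the times [t] and [t + s] the midpoint defect is at most the spatial oscillation [s];
    subtracting and dividing by [s] leaves 2. This is why the mesh has to be fine in terms of
    [s]. *)
Lemma dquot_midpoint (L s t : R) (f g : R -> R -> R) (a b : R) :
  0 < s -> 0 <= t -> Icc L a -> Icc L b -> a < b ->
  (forall x t, Icc L x -> 0 <= t -> has_deriv (Icc L) (fun y => f y t) x (g x t)) ->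
  (forall x y r, Icc L x -> Icc L y -> t <= r <= t + s -> Rabs (y - x) <= b - a ->
     Rabs (g y r - g x r) <= s) ->
  Rabs ((dquot s g a t + dquot s g b t) / 2 - (dquot s f b t - dquot s f a t) / (b - a)) <= 2.
Proof.
  intros Hs Ht Ha Hb Hab Hf Hg.
  assert (Q : forall r, t <= r <= t + s ->
    Rabs ((g a r + g b r) / 2 - (f b r - f a r) / (b - a)) <= s).
  { intros r Hr. apply (midpoint_quotient L (fun y => f y r) (fun y => g y r)); trivial.
    - intros x Hx. apply Hf; [exact Hx | lra].
    - intros x y Hx Hy. now apply Hg. }
  assert (Q1 := Q t ltac:(lra)). assert (Q2 := Q (t + s) ltac:(lra)). clear Q.
  set (E1 := (g a t + g b t) / 2 - (f b t - f a t) / (b - a)) in Q1.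
  set (E2 := (g a (t + s) + g b (t + s)) / 2 - (f b (t + s) - f a (t + s)) / (b - a)) in Q2.
  replace (_ - _) with ((E2 - E1) / s) by (unfold E1, E2, dquot; field; lra).
  unfold Rdiv. rewrite Rabs_mult, (Rabs_pos_eq (/ s))
    by now apply Rlt_le, Rinv_0_lt_compat.
  apply Rmult_le_reg_r with s; [exact Hs|].
  rewrite Rmult_assoc, Rinv_l, Rmult_1_r by lra.
  apply Rabs_le_between in Q1, Q2. apply Rabs_le. lra.
Qed.

(** A solution together with its first derivatives: [a = u_x], [b = w_x = u_t], [c = w_t]. The
    equations [u_t = w_x] are encoded by the shared [b]. *)
Definition wave_solution (L rho mu alpha beta gamma k1 k2 : R)
    (u1 u2 w1 w2 a1 a2 b1 b2 c1 c2 : R -> R -> R) : Prop :=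
  (forall x t, Icc L x -> 0 <= t ->
     has_deriv (Icc L) (fun y => u1 y t) x (a1 x t) /\
     has_deriv (Icc L) (fun y => u2 y t) x (a2 x t) /\
     has_deriv (Icc L) (fun y => w1 y t) x (b1 x t) /\
     has_deriv (Icc L) (fun y => w2 y t) x (b2 x t)) /\
  (forall x t, Icc L x -> 0 <= t ->
     has_deriv Ici (u1 x) t (b1 x t) /\ has_deriv Ici (u2 x) t (b2 x t) /\
     has_deriv Ici (w1 x) t (c1 x t) /\ has_deriv Ici (w2 x) t (c2 x t)) /\
  (forall x t, Icc L x -> 0 <= t ->
     rho * c1 x t = alpha * a1 x t - gamma * beta * a2 x t /\
     mu * c2 x t = beta * a2 x t - gamma * beta * a1 x t) /\
  (jcont L a1 /\ jcont L a2 /\ jcont L b1 /\ jcont L b2 /\ jcont L c1 /\ jcont L c2) /\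
  (forall t, 0 <= t ->
     w1 0 t = 0 /\ w2 0 t = 0 /\
     alpha * u1 L t - gamma * beta * u2 L t = - k1 * w1 L t /\
     beta * u2 L t - gamma * beta * u1 L t = - k2 * w2 L t).

Lemma has_deriv_derivable_in (D : R -> Prop) (f : R -> R) (x l : R) :
  has_deriv D f x l -> derivable_in D f x.
Proof. now exists l. Qed.

(** The sources are taken to be the left-hand sides themselves, so the content lies in
    differentiability and in the boundary conditions, which are linear and hold at [t] and at
    [t + s]. *)
Lemma scheme_dquot (L rho mu alpha beta gamma k1 k2 : R)
    (u1 u2 w1 w2 a1 a2 b1 b2 c1 c2 : R -> R -> R) (N : nat) (s : R) :
  0 < L -> 0 < s ->
  wave_solution L rho mu alpha beta gamma k1 k2 u1 u2 w1 w2 a1 a2 b1 b2 c1 c2 ->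
  let Q f := nodal L N (dquot s f) in
  let h := mesh L N in
  scheme L rho mu alpha beta gamma k1 k2 N
    (lhs_u h (Q u1) (Q w1)) (lhs_u h (Q u2) (Q w2))
    (lhs_w1 h rho alpha beta gamma (Q w1) (Q u1) (Q u2))
    (lhs_w2 h mu beta gamma (Q w2) (Q u1) (Q u2))
    (fun j => Q u1 j 0) (fun j => Q u2 j 0) (fun j => Q w1 j 0) (fun j => Q w2 j 0)
    (Q u1) (Q u2) (Q w1) (Q w2).
Proof.
  intros HL Hs [_ [Hdt [_ [_ Hbc]]]] Q h. split; [|split; [|split]].
  - intros j t Hj Ht. assert (Hx := node_range L N j HL Hj).
    repeat split; eapply has_deriv_derivable_in; apply has_deriv_dquot_t;
      try lra; intros r Hr; apply (Hdt _ r Hx Hr).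
  - intros j t _ _. now repeat split.
  - intros t Ht. unfold Q, nodal, node. rewrite mesh_mult. simpl (INR 0).
    rewrite Rmult_0_l.
    destruct (Hbc t Ht) as [Z1 [Z2 [Y1 Y2]]].
    destruct (Hbc (t + s) ltac:(lra)) as [Z1' [Z2' [Y1' Y2']]].
    unfold dquot. rewrite Z1, Z2, Z1', Z2'. repeat split.
    + field. lra.
    + field. lra.
    + transitivity (((alpha * u1 L (t + s) - gamma * beta * u2 L (t + s))
        - (alpha * u1 L t - gamma * beta * u2 L t)) / s); [field; lra|].
      rewrite Y1, Y1'. field. lra.
    + transitivity (((beta * u2 L (t + s) - gamma * beta * u1 L (t + s))
        - (beta * u2 L t - gamma * beta * u1 L t)) / s); [field; lra|].
      rewrite Y2, Y2'. field. lra.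
  - now repeat split.
Qed.

(** The quotient commutes with [d_t], and the wave equations turn time derivatives at the nodes into
    [x]-derivatives. What remains is one midpoint defect per spatial difference, each at most 2, and
    [sigma] adds them with their coefficients. *)
Lemma dquot_source_bound (L rho mu alpha beta gamma k1 k2 : R)
    (u1 u2 w1 w2 a1 a2 b1 b2 c1 c2 : R -> R -> R) (N j : nat) (s t : R) :
  0 < L -> 0 < alpha -> 0 < beta -> 0 < gamma -> 0 < s -> 0 <= t -> (j <= N)%nat ->
  wave_solution L rho mu alpha beta gamma k1 k2 u1 u2 w1 w2 a1 a2 b1 b2 c1 c2 ->
  (forall x y r, Icc L x -> Icc L y -> t <= r <= t + s -> Rabs (y - x) <= mesh L N ->
     Rabs (a1 y r - a1 x r) <= s /\ Rabs (a2 y r - a2 x r) <= s /\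
     Rabs (b1 y r - b1 x r) <= s /\ Rabs (b2 y r - b2 x r) <= s) ->
  let Q f := nodal L N (dquot s f) in
  let h := mesh L N in
  let sigma := 2 * (1 + alpha + beta + 2 * (gamma * beta)) in
  Rabs (lhs_u h (Q u1) (Q w1) j t) <= sigma /\
  Rabs (lhs_u h (Q u2) (Q w2) j t) <= sigma /\
  Rabs (lhs_w1 h rho alpha beta gamma (Q w1) (Q u1) (Q u2) j t) <= sigma /\
  Rabs (lhs_w2 h mu beta gamma (Q w2) (Q u1) (Q u2) j t) <= sigma.
Proof.
  intros HL Ha Hb Hg Hs Ht Hj [Hdx [Hdt [Hw _]]] Hosc Q h sigma.
  assert (Hgb : 0 < gamma * beta) by nra.
  assert (X0 := node_range L N j HL ltac:(lia)).
  assert (X1 := node_range L N (S j) HL ltac:(lia)).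
  assert (Hh : 0 < h) by now apply mesh_pos.
  assert (Es := node_succ L N j). fold h in Es.
  set (x := node L N j) in *. set (x' := node L N (S j)) in *.
  assert (Eh : x' - x = h) by lra.
  assert (DM : forall f g,
     (forall x t, Icc L x -> 0 <= t -> has_deriv Ici (f x) t (g x t)) ->
     Dt (mid (Q f) j) t = (dquot s g x t + dquot s g x' t) / 2).
  { intros f g Hf. apply Dt_eq; [exact Ht|].
    apply has_deriv_mid; apply has_deriv_dquot_t; try lra; intros r Hr; now apply Hf. }
  assert (CE : forall f g,
     (forall x t, Icc L x -> 0 <= t -> has_deriv (Icc L) (fun y => f y t) x (g x t)) ->
     (forall x y r, Icc L x -> Icc L y -> t <= r <= t + s -> Rabs (y - x) <= h ->
        Rabs (g y r - g x r) <= s) ->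
     Rabs ((dquot s g x t + dquot s g x' t) / 2 - delta h (Q f) j t) <= 2).
  { intros f g Hf Hgs. unfold delta, Q, nodal. fold x x'. rewrite <- Eh.
    apply (dquot_midpoint L); trivial; [lra|]. now rewrite Eh. }
  generalize (CE u1 a1 ltac:(intros; now apply Hdx) ltac:(intros; now apply Hosc))
    (CE u2 a2 ltac:(intros; now apply Hdx) ltac:(intros; now apply Hosc))
    (CE w1 b1 ltac:(intros; now apply Hdx) ltac:(intros; now apply Hosc))
    (CE w2 b2 ltac:(intros; now apply Hdx) ltac:(intros; now apply Hosc)).
  intros C1 C2 C3 C4.
  assert (Dw : forall y, Icc L y ->
     rho * dquot s c1 y t = alpha * dquot s a1 y t - gamma * beta * dquot s a2 y t /\
     mu * dquot s c2 y t = beta * dquot s a2 y t - gamma * beta * dquot s a1 y t).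
  { intros y Hy. unfold dquot.
    destruct (Hw y t Hy Ht) as [W1 W2].
    destruct (Hw y (t + s) Hy ltac:(lra)) as [W1' W2']. split.
    - transitivity ((rho * c1 y (t + s) - rho * c1 y t) / s); [field; lra|].
      rewrite W1, W1'. field. lra.
    - transitivity ((mu * c2 y (t + s) - mu * c2 y t) / s); [field; lra|].
      rewrite W2, W2'. field. lra. }
  destruct (Dw x X0) as [V1 V2]. destruct (Dw x' X1) as [V1' V2'].
  unfold lhs_u, lhs_w1, lhs_w2.
  rewrite (DM u1 b1), (DM u2 b2), (DM w1 c1), (DM w2 c2) by (intros; now apply Hdt).
  set (A1 := (dquot s a1 x t + dquot s a1 x' t) / 2) in *.
  set (A2 := (dquot s a2 x t + dquot s a2 x' t) / 2) in *.
  set (B1 := (dquot s b1 x t + dquot s b1 x' t) / 2) in *.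
  set (B2 := (dquot s b2 x t + dquot s b2 x' t) / 2) in *.
  replace (rho * ((dquot s c1 x t + dquot s c1 x' t) / 2))
    with (alpha * A1 - gamma * beta * A2)
    by (unfold A1, A2; replace (rho * _) with ((rho * dquot s c1 x t + rho * dquot s c1 x' t) / 2)
          by field; rewrite V1, V1'; field).
  replace (mu * ((dquot s c2 x t + dquot s c2 x' t) / 2))
    with (beta * A2 - gamma * beta * A1)
    by (unfold A1, A2; replace (mu * _) with ((mu * dquot s c2 x t + mu * dquot s c2 x' t) / 2)
          by field; rewrite V2, V2'; field).
  clearbody A1 A2 B1 B2.
  apply Rabs_le_between in C1, C2, C3, C4. unfold sigma.
  repeat split; apply Rabs_le; try lra.
  - assert (T1 : - (alpha * 2) <= alpha * (A1 - delta h (Q u1) j t) <= alpha * 2) by (split; nra).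
    assert (T2 : - (gamma * beta * 2) <= gamma * beta * (A2 - delta h (Q u2) j t)
              <= gamma * beta * 2) by (split; nra). lra.
  - assert (T1 : - (beta * 2) <= beta * (A2 - delta h (Q u2) j t) <= beta * 2) by (split; nra).
    assert (T2 : - (gamma * beta * 2) <= gamma * beta * (A1 - delta h (Q u1) j t)
              <= gamma * beta * 2) by (split; nra). lra.
Qed.

Lemma jcont_uniform_list (L T : R) (l : list (R -> R -> R)) :
  0 < L -> 0 <= T -> (forall g, In g l -> jcont L g) ->
  forall e, 0 < e -> exists d, 0 < d /\ forall g, In g l ->
    forall x y t s, Icc L x -> Icc L y -> 0 <= t <= T -> 0 <= s <= T ->
      Rabs (y - x) < d -> Rabs (s - t) < d -> Rabs (g y s - g x t) < e.
Proof.
  intros HL HT H e He. induction l as [|f l IH].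
  - exists 1. split; [lra|]. intros g [].
  - destruct IH as [a [Ha Ka]]; [intros g Hg; apply H; now right|].
    destruct (jcont_uniform L T f HL HT (H f (or_introl eq_refl)) e He) as [b [Hb Kb]].
    exists (Rmin a b). split; [now apply Rmin_pos|].
    intros g Hg x y t s Hx Hy Ht Hs H1 H2.
    generalize (Rmin_l a b) (Rmin_r a b). intros.
    destruct Hg as [<-|Hg]; [apply Kb | apply (Ka g Hg)]; trivial; lra.
Qed.

(** Passes from the discrete [L^2] norm to the [L^1] norm term by term, in place of the
    Cauchy-Schwarz inequality. *)
Lemma Rabs_le_sqr_plus_1 (z : R) : Rabs z <= z ^ 2 + 1.
Proof. rewrite <- pow2_abs. generalize (pow2_ge_0 (Rabs z - 1)) (Rabs_pos z). nra. Qed.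

Lemma Rabs_mid_le (a b B : R) : Rabs a <= B -> Rabs b <= B -> Rabs ((a + b) / 2) <= B.
Proof.
  intros H1 H2. apply Rabs_le_between in H1, H2. apply Rabs_le. lra.
Qed.

(* The difference quotients [dquot s] in time solve the scheme with sources
   bounded independently of [t] once the mesh is fine in terms of [s]; so
   [scheme_stable] bounds the discrete L2 norm of the first derivatives uniformly
   in time, without integrals and without second derivatives. *)
Lemma gradient_sum_bound (L rho mu alpha beta gamma k1 k2 : R)
    (u1 u2 w1 w2 a1 a2 b1 b2 c1 c2 : R -> R -> R) :
  0 < L -> 0 < rho -> 0 < mu -> 0 < alpha -> 0 < beta -> 0 < gamma ->
  0 < alpha1 alpha beta gamma -> 0 < k1 -> 0 < k2 ->
  wave_solution L rho mu alpha beta gamma k1 k2 u1 u2 w1 w2 a1 a2 b1 b2 c1 c2 ->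
  exists C, forall t, 0 <= t -> exists N, forall g, In g (a1 :: a2 :: b1 :: b2 :: nil) ->
    (forall x y, Icc L x -> Icc L y -> Rabs (y - x) <= mesh L N ->
       Rabs (g y t - g x t) <= 1) /\
    sum_f_R0 (fun j => mesh L N
      * Rabs ((g (node L N j) t + g (node L N (S j)) t) / 2)) N <= C.
Proof.
  intros HL Hr Hm Hal Hb Hg Ha Hk1 Hk2 W.
  assert (W' := W). destruct W' as [Hdx [Hdt [Hw [[J1 [J2 [J3 [J4 [J5 J6]]]]] Hbc]]]].
  destruct (quad_lower rho mu alpha beta gamma Hr Hm Hb Ha) as [m [Pm Lm]].
  destruct (quad_upper rho mu alpha beta gamma Hr Hm Hal Hb Hg) as [M [HM UM]].
  destruct (stress_bound alpha beta gamma Hb Hg Ha) as [Cs [HCs SB]].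
  destruct (scheme_stable L rho mu alpha beta gamma k1 k2 HL Hr Hm Hal Hb Hg Ha Hk1 Hk2)
    as [K [HK ST]].
  destruct (jcont_bounded L 0 b1 HL (Rle_refl 0) J3) as [B1 [P1 HB1]].
  destruct (jcont_bounded L 0 b2 HL (Rle_refl 0) J4) as [B2 [P2 HB2]].
  destruct (jcont_bounded L 0 c1 HL (Rle_refl 0) J5) as [B3 [P3 HB3]].
  destruct (jcont_bounded L 0 c2 HL (Rle_refl 0) J6) as [B4 [P4 HB4]].
  (* The final constant is built from data at time 0, before [t] is introduced. [B] bounds the
     initial quotients, with [+ 1] for their distance to the derivatives; [E1] is the resulting
     energy bound, and [Kk] is the price of recovering [a1, a2] from [c1, c2]. *)
  set (B := B1 + B2 + B3 + B4 + 1).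
  set (sg := 2 * (1 + alpha + beta + 2 * (gamma * beta))).
  set (E1 := K * (L * (2 * M * B ^ 2) + sg ^ 2)).
  set (Kk := 1 + Cs * (rho + mu)).
  assert (HKk : 1 <= Kk) by (unfold Kk; nra).
  exists (Kk * (2 * E1 / m + L * 2)). intros t Ht.
  (* Quotients at times up to [t] look ahead by [s < 1], hence the interval [[0, t + 1]]. This
     modulus determines [s], so that the quotients lie within 1 of the derivatives. *)
  destruct (jcont_uniform_list L (t + 1) (b1 :: b2 :: c1 :: c2 :: nil) HL ltac:(lra))
    with (e := 1) as [d [Hd Kd]]; [|lra|].
  { intros g [<-|[<-|[<-|[<-|[]]]]]; assumption. }
  set (s := Rmin d 1 / 2).
  assert (Hs : 0 < s) by (generalize (Rmin_pos d 1 Hd Rlt_0_1); unfold s; lra).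
  assert (Hs1 : s < 1) by (generalize (Rmin_r d 1); unfold s in *; lra).
  assert (Hsd : s < d) by (generalize (Rmin_l d 1); unfold s in *; lra).
  (* Only now is the mesh chosen: the spatial oscillation over one cell must be at most [s]. *)
  destruct (jcont_uniform_list L (t + 1) (a1 :: a2 :: b1 :: b2 :: nil) HL ltac:(lra))
    with (e := s) as [d' [Hd' Kd']]; [|exact Hs|].
  { intros g [<-|[<-|[<-|[<-|[]]]]]; assumption. }
  destruct (mesh_small L d' HL Hd') as [N HN].
  assert (Hh : 0 < mesh L N) by now apply mesh_pos.
  exists N.
  assert (Osc : forall g, In g (a1 :: a2 :: b1 :: b2 :: nil) ->
     forall x y r, Icc L x -> Icc L y -> 0 <= r <= t + 1 -> Rabs (y - x) <= mesh L N ->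
     Rabs (g y r - g x r) <= s).
  { intros g Hgl x y r Hx Hy Hrt Hxy. apply Rlt_le, Kd'; trivial; [lra|].
    now rewrite Rminus_diag, Rabs_R0. }
  assert (Near : forall f g, In g (b1 :: b2 :: c1 :: c2 :: nil) ->
     (forall x r, Icc L x -> 0 <= r -> has_deriv Ici (f x) r (g x r)) ->
     forall x r, Icc L x -> 0 <= r <= t -> Rabs (dquot s f x r - g x r) <= 1).
  { intros f g Hgl Hf x r Hx Hrt. apply dquot_near; trivial; [lra | intros; now apply Hf|].
    intros r' Hr'. apply Rlt_le, Kd; trivial; try lra.
    - rewrite Rminus_diag, Rabs_R0. exact Hd.
    - rewrite Rabs_pos_eq; lra. }
  assert (Nu1 := Near u1 b1 ltac:(simpl; tauto) ltac:(intros; now apply Hdt)).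
  assert (Nu2 := Near u2 b2 ltac:(simpl; tauto) ltac:(intros; now apply Hdt)).
  assert (Nw1 := Near w1 c1 ltac:(simpl; tauto) ltac:(intros; now apply Hdt)).
  assert (Nw2 := Near w2 c2 ltac:(simpl; tauto) ltac:(intros; now apply Hdt)).
  clear Near Kd Kd'.
  set (Q := fun f => nodal L N (dquot s f)).
  assert (Nd : forall j, (j <= N)%nat -> Icc L (node L N j) /\ Icc L (node L N (S j))).
  { intros j Hj. split; apply node_range; trivial; lia. }
  set (e := energy L rho mu alpha beta gamma N (Q u1) (Q u2) (Q w1) (Q w2)).
  assert (Est : e t <= K * (e 0 + sg ^ 2)).
  { apply (ST N _ _ _ _ _ _ _ _ _ _ _ _ t sg Ht
      (scheme_dquot _ _ _ _ _ _ _ _ _ _ _ _ _ _ _ _ _ _ N s HL Hs W)).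
    intros j r Hj Hrt.
    apply (dquot_source_bound L rho mu alpha beta gamma k1 k2 u1 u2 w1 w2
             a1 a2 b1 b2 c1 c2); trivial; [lra|].
    intros x y r' Hx Hy Hr' Hxy. repeat split; apply Osc; simpl; try tauto; lra. }
  assert (E0 : e 0 <= L * (2 * M * B ^ 2)).
  { unfold e. rewrite energy_quad, <- (sum_mesh L _ N).
    replace (mesh L N / 2 * _) with (mesh L N / 2 * 1 *
      sum_f_R0 (fun j => quad rho mu alpha beta gamma (mid (Q u1) j 0)
        (mid (Q u2) j 0) (mid (Q w1) j 0) (mid (Q w2) j 0)) N) by ring.
    rewrite Rmult_1_r, scal_sum. apply sum_Rle. intros j Hj.
    destruct (Nd j Hj) as [X X'].
    assert (Bd : forall f g b, b + 1 <= B ->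
       (forall x, Icc L x -> Rabs (g x 0) <= b) ->
       (forall x r, Icc L x -> 0 <= r <= t -> Rabs (dquot s f x r - g x r) <= 1) ->
       mid (Q f) j 0 ^ 2 <= B ^ 2).
    { intros f g b HbB Hgb Hn. rewrite <- pow2_abs. apply pow_incr.
      split; [apply Rabs_pos|]. unfold mid, Q, nodal. apply Rabs_mid_le.
      - generalize (Hgb _ X) (Hn _ 0 X ltac:(lra)). intros Y1 Y2.
        apply Rabs_le_between in Y1, Y2. apply Rabs_le. lra.
      - generalize (Hgb _ X') (Hn _ 0 X' ltac:(lra)). intros Y1 Y2.
        apply Rabs_le_between in Y1, Y2. apply Rabs_le. lra. }
    generalize (Bd u1 b1 B1 ltac:(unfold B; lra) HB1 Nu1)
      (Bd u2 b2 B2 ltac:(unfold B; lra) HB2 Nu2)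
      (Bd w1 c1 B3 ltac:(unfold B; lra) HB3 Nw1)
      (Bd w2 c2 B4 ltac:(unfold B; lra) HB4 Nw2). intros T1 T2 T3 T4.
    specialize (UM (mid (Q u1) j 0) (mid (Q u2) j 0) (mid (Q w1) j 0) (mid (Q w2) j 0)).
    set (q := quad _ _ _ _ _ _ _ _ _) in *.
    assert (q <= 4 * M * B ^ 2) by nra. nra. }
  assert (Et : e t <= E1) by (eapply Rle_trans; [exact Est | unfold E1; nra]).
  set (n := fun j => mid (Q u1) j t ^ 2 + mid (Q u2) j t ^ 2
                     + mid (Q w1) j t ^ 2 + mid (Q w2) j t ^ 2).
  assert (Sn : sum_f_R0 (fun j => mesh L N * n j) N <= 2 * E1 / m).
  { apply Rmult_le_reg_r with m; [exact Pm|].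
    replace (2 * E1 / m * m) with (2 * E1) by (field; lra).
    apply Rle_trans with (2 * e t); [|lra]. unfold e. rewrite energy_quad.
    replace (2 * (mesh L N / 2 * _)) with (mesh L N *
      sum_f_R0 (fun j => quad rho mu alpha beta gamma (mid (Q u1) j t)
        (mid (Q u2) j t) (mid (Q w1) j t) (mid (Q w2) j t)) N) by field.
    rewrite Rmult_comm, !scal_sum. apply sum_Rle. intros j Hj.
    specialize (Lm (mid (Q u1) j t) (mid (Q u2) j t) (mid (Q w1) j t) (mid (Q w2) j t)).
    fold (n j) in Lm. nra. }
  (* In [+ 2], one unit replaces derivatives by quotients and the other comes from
     [|z| <= z^2 + 1]. *)
  assert (Md : forall f g, 
     (forall x r, Icc L x -> 0 <= r <= t -> Rabs (dquot s f x r - g x r) <= 1) ->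
     forall j, (j <= N)%nat ->
     Rabs ((g (node L N j) t + g (node L N (S j)) t) / 2) <= mid (Q f) j t ^ 2 + 2).
  { intros f g Hn j Hj. destruct (Nd j Hj) as [X X'].
    assert (Y1 := Hn _ t X ltac:(lra)). assert (Y2 := Hn _ t X' ltac:(lra)).
    assert (Y3 := Rabs_le_sqr_plus_1 (mid (Q f) j t)).
    set (z := mid (Q f) j t) in *. assert (Ez : z = (dquot s f (node L N j) t
      + dquot s f (node L N (S j)) t) / 2) by reflexivity.
    clearbody z. apply Rabs_le_between in Y1, Y2, Y3. apply Rabs_le. lra. }
  assert (Sq : forall f j, 0 <= mid (Q f) j t ^ 2) by (intros; apply pow2_ge_0).
  (* For [b1, b2] this is [Md]. The averages of [a1, a2] are found from those of [c1, c2] by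
     inverting [S a = R c]. *)
  assert (Mall : forall g, In g (a1 :: a2 :: b1 :: b2 :: nil) -> forall j, (j <= N)%nat ->
     Rabs ((g (node L N j) t + g (node L N (S j)) t) / 2) <= Kk * (n j + 2)).
  { intros g Hgl j Hj. destruct (Nd j Hj) as [X X'].
    assert (Z1 := Md u1 b1 Nu1 j Hj). assert (Z2 := Md u2 b2 Nu2 j Hj).
    assert (Z3 := Md w1 c1 Nw1 j Hj). assert (Z4 := Md w2 c2 Nw2 j Hj).
    generalize (Sq u1 j) (Sq u2 j) (Sq w1 j) (Sq w2 j). intros S1 S2 S3 S4.
    assert (Hn : 0 <= n j) by (unfold n; lra).
    destruct (Hw _ t X Ht) as [V1 V2]. destruct (Hw _ t X' Ht) as [V1' V2'].
    set (x := node L N j) in *. set (x' := node L N (S j)) in *.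
    destruct (SB ((a1 x t + a1 x' t) / 2) ((a2 x t + a2 x' t) / 2)
      ((rho + mu) * (n j + 2))) as [A1 A2].
    - replace (alpha * _ - _) with (rho * ((c1 x t + c1 x' t) / 2)).
      2:{ transitivity ((rho * c1 x t + rho * c1 x' t) / 2); [field|].
          rewrite V1, V1'. field. }
      rewrite Rabs_mult, (Rabs_pos_eq rho) by lra.
      apply Rmult_le_compat; [lra | apply Rabs_pos | lra | unfold n; lra].
    - replace (beta * _ - _) with (mu * ((c2 x t + c2 x' t) / 2)).
      2:{ transitivity ((mu * c2 x t + mu * c2 x' t) / 2); [field|].
          rewrite V2, V2'. field. }
      rewrite Rabs_mult, (Rabs_pos_eq mu) by lra.
      apply Rmult_le_compat; [lra | apply Rabs_pos | lra | unfold n; lra].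
    - assert (Y : n j + 2 <= Kk * (n j + 2)) by nra.
      assert (Y' : Cs * ((rho + mu) * (n j + 2)) <= Kk * (n j + 2))
        by (unfold Kk; lra).
      destruct Hgl as [<-|[<-|[<-|[<-|[]]]]]; unfold n in *; lra. }
  intros g Hgl. split.
  - intros x y Hx Hy Hxy.
    generalize (Osc g Hgl x y t Hx Hy ltac:(lra) Hxy). lra.
  - apply Rle_trans with (Kk * (sum_f_R0 (fun j => mesh L N * n j) N
       + sum_f_R0 (fun j => mesh L N * 2) N)).
    + rewrite <- sum_plus, scal_sum. apply sum_Rle. intros j Hj.
      generalize (Mall g Hgl j Hj). nra.
    + rewrite sum_mesh. apply Rmult_le_compat_l; lra.
Qed.

(** The increments in [x] are bounded by the gradient estimate. Since [w] vanishes at 0, it is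
    bounded everywhere; the damping conditions then bound [u] at [L], and two increments through 0
    carry this bound to any [x]. *)
Lemma wave_bounded (L rho mu alpha beta gamma k1 k2 : R)
    (u1 u2 w1 w2 a1 a2 b1 b2 c1 c2 : R -> R -> R) :
  0 < L -> 0 < rho -> 0 < mu -> 0 < alpha -> 0 < beta -> 0 < gamma ->
  0 < alpha1 alpha beta gamma -> 0 < k1 -> 0 < k2 ->
  wave_solution L rho mu alpha beta gamma k1 k2 u1 u2 w1 w2 a1 a2 b1 b2 c1 c2 ->
  exists B, forall x t, Icc L x -> 0 <= t ->
    Rabs (u1 x t) <= B /\ Rabs (u2 x t) <= B /\
    Rabs (w1 x t) <= B /\ Rabs (w2 x t) <= B.
Proof.
  intros HL Hr Hm Hal Hb Hg Ha Hk1 Hk2 W.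
  destruct (gradient_sum_bound _ _ _ _ _ _ _ _ _ _ _ _ _ _ _ _ _ _
    HL Hr Hm Hal Hb Hg Ha Hk1 Hk2 W) as [C HC].
  destruct W as [Hdx [_ [_ [_ Hbc]]]].
  destruct (stress_bound alpha beta gamma Hb Hg Ha) as [Cs [HCs SB]].
  set (C2 := C + L).
  exists (2 * C2 + Cs * ((k1 + k2) * C2) + C2). intros x t Hx Ht.
  destruct (HC t Ht) as [N HN].
  assert (Inc : forall f g, In g (a1 :: a2 :: b1 :: b2 :: nil) ->
    (forall y, Icc L y -> has_deriv (Icc L) (fun y => f y t) y (g y t)) ->
    forall y, Icc L y -> Rabs (f y t - f 0 t) <= C2).
  { intros f g Hgl Hf. destruct (HN g Hgl) as [H1 H2].
    now apply (increment_bound L N (fun y => f y t) (fun y => g y t) C). }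
  assert (I1 := Inc u1 a1 ltac:(simpl; tauto) ltac:(intros; now apply Hdx)).
  assert (I2 := Inc u2 a2 ltac:(simpl; tauto) ltac:(intros; now apply Hdx)).
  assert (I3 := Inc w1 b1 ltac:(simpl; tauto) ltac:(intros; now apply Hdx)).
  assert (I4 := Inc w2 b2 ltac:(simpl; tauto) ltac:(intros; now apply Hdx)).
  destruct (Hbc t Ht) as [Z1 [Z2 [Y1 Y2]]].
  assert (HLL : Icc L L) by (unfold Icc; lra).
  rewrite Z1 in I3. rewrite Z2 in I4.
  assert (HC2 : 0 <= C2) by (eapply Rle_trans; [apply Rabs_pos | exact (I1 L HLL)]).
  assert (HCC : 0 <= Cs * ((k1 + k2) * C2)) by (apply Rmult_le_pos; nra).
  destruct (SB (u1 L t) (u2 L t) ((k1 + k2) * C2)) as [U1 U2].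
  { rewrite Y1, Rabs_mult, Rabs_Ropp, (Rabs_pos_eq k1) by lra.
    assert (X := I3 L HLL). rewrite Rminus_0_r in X.
    apply Rmult_le_compat; [lra | apply Rabs_pos | lra | lra]. }
  { rewrite Y2, Rabs_mult, Rabs_Ropp, (Rabs_pos_eq k2) by lra.
    assert (X := I4 L HLL). rewrite Rminus_0_r in X.
    apply Rmult_le_compat; [lra | apply Rabs_pos | lra | lra]. }
  assert (X1 := I1 x Hx). assert (X1' := I1 L HLL).
  assert (X2 := I2 x Hx). assert (X2' := I2 L HLL).
  assert (X3 := I3 x Hx). assert (X4 := I4 x Hx).
  apply Rabs_le_between in X1, X1', X2, X2', X3, X4, U1, U2.
  repeat split; apply Rabs_le; lra.
Qed.

(** * Regularity of the solution and residuals *)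

(** Computes iterated derivatives of a combination, such as a difference quotient, once a chain of
    derivatives [h] has been exhibited. *)
Lemma Derive_n_in_eq (L : R) (k : nat) (f : R -> R) (h : nat -> R -> R) :
  0 < L -> (forall x, Icc L x -> h 0%nat x = f x) ->
  (forall i x, (i < k)%nat -> Icc L x -> has_deriv (Icc L) (h i) x (h (S i) x)) ->
  forall i x, (i <= k)%nat -> Icc L x -> Derive_n_in (Icc L) i f x = h i x.
Proof.
  intros HL H0 Hh. induction i as [|i IH]; intros x Hi Hx; [now rewrite H0|].
  apply Derive_in_unique; [now apply adhDa_Icc|].
  apply has_deriv_ext with (h i); [exact Hx | | now apply Hh].
  intros y Hy. symmetry. apply IH; [lia | exact Hy].
Qed.

Lemma in_Ck_deriv (k : nat) (L : R) (f : R -> R) (i : nat) (x : R) :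
  0 < L -> in_Ck k L f -> (i < k)%nat -> Icc L x ->
  has_deriv (Icc L) (Derive_n_in (Icc L) i f) x (Derive_n_in (Icc L) (S i) f x).
Proof.
  intros HL [Hf _] Hi Hx.
  apply has_deriv_Derive_in; [now apply adhDa_Icc | now apply Hf].
Qed.

Lemma in_Ck_cont (k : nat) (L : R) (f : R -> R) (i : nat) (x : R) :
  0 < L -> in_Ck k L f -> (i <= k)%nat -> Icc L x ->
  cont_in (Icc L) (Derive_n_in (Icc L) i f) x.
Proof.
  intros HL Hf Hi Hx. destruct (Nat.eq_dec i k) as [->|N].
  - apply continue_in_cont_in. now apply (proj2 Hf).
  - eapply has_deriv_cont_in. apply (in_Ck_deriv k L f i x); trivial. lia.
Qed.

Lemma Ck_norm_lt (k : nat) (L e : R) (f : R -> R) :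
  Rbar_lt (Ck_norm k L f) e -> forall i x, (i <= k)%nat -> Icc L x ->
  Rabs (Derive_n_in (Icc L) i f x) < e.
Proof.
  intros H i x Hi Hx. change (Rbar_lt (Rabs (Derive_n_in (Icc L) i f x)) e).
  eapply Rbar_le_lt_trans; [|exact H].
  apply (proj1 (Lub_Rbar_correct (fun y => exists (i : nat) (x : R),
    (i <= k)%nat /\ Icc L x /\ y = Rabs (Derive_n_in (Icc L) i f x)))).
  now exists i, x.
Qed.

Definition dnx (L : R) (f : R -> R -> R) (i : nat) (x t : R) : R :=
  Derive_n_in (Icc L) i (fun y => f y t) x.

(** The pointwise content of [in_C1_Ck]: with [F i] the [i]-th [x]-derivative of [f], the function
    [G i] is at once [d_t d_x^i f] and [d_x^i d_t f]. *)
Definition tower (k : nat) (L : R) (F G : nat -> R -> R -> R) : Prop :=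
  (forall i x t, (i < k)%nat -> Icc L x -> 0 <= t ->
     has_deriv (Icc L) (fun y => F i y t) x (F (S i) x t)) /\
  (forall i x t, (i < k)%nat -> Icc L x -> 0 <= t ->
     has_deriv (Icc L) (fun y => G i y t) x (G (S i) x t)) /\
  (forall i x t, (i <= k)%nat -> Icc L x -> 0 <= t ->
     has_deriv Ici (F i x) t (G i x t)) /\
  (forall i, (i <= k)%nat -> jcont L (F i)) /\
  (forall i, (i <= k)%nat -> jcont L (G i)).

(** Near [(x, t)] the time derivative is bounded by [M], so [f] is Lipschitz in time uniformly in
    nearby [y]; continuity in [x] is then used at the single time [t]. *)
Lemma jcont_of_deriv (L : R) (f g : R -> R -> R) :
  (forall x t, Icc L x -> 0 <= t -> has_deriv Ici (f x) t (g x t)) ->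
  (forall x t, Icc L x -> 0 <= t -> cont_in (Icc L) (fun y => f y t) x) ->
  jcont L g -> jcont L f.
Proof.
  intros Hd Hc Hg x t Hx Ht e He.
  destruct (Hg x t Hx Ht 1 Rlt_0_1) as [a [Ha Ka]].
  destruct (Hc x t Hx Ht (e / 2) ltac:(lra)) as [b [Hb Kb]].
  set (M := Rabs (g x t) + 1).
  assert (HM : 0 < M) by (unfold M; generalize (Rabs_pos (g x t)); lra).
  assert (HeM : 0 < e / 2 / M) by (apply Rdiv_lt_0_compat; lra).
  exists (Rmin (Rmin a b) (e / 2 / M)).
  split; [repeat apply Rmin_pos; assumption|]. intros y s Hy Hs H1 H2.
  assert (A : Rmin (Rmin a b) (e / 2 / M) <= a)
    by (eapply Rle_trans; [apply Rmin_l | apply Rmin_l]).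
  assert (B : Rmin (Rmin a b) (e / 2 / M) <= b)
    by (eapply Rle_trans; [apply Rmin_l | apply Rmin_r]).
  assert (E : Rmin (Rmin a b) (e / 2 / M) <= e / 2 / M) by apply Rmin_r.
  assert (Gb : forall r, 0 <= r -> Rabs (r - t) < a -> Rabs (g y r) <= M).
  { intros r Hr Hrt. generalize (Ka y r Hy Hr ltac:(lra) Hrt). intros X.
    replace (g y r) with (g x t + (g y r - g x t)) by ring.
    eapply Rle_trans; [apply Rabs_triang | unfold M; lra]. }
  assert (T : Rabs (f y s - f y t) <= M * Rabs (s - t)).
  { destruct (Rtotal_order s t) as [Hst|[->|Hst]].
    - destruct (MVT_in Ici (f y) (g y) s t) as [c [Hc' Ec]];
        [exact Hst | unfold Ici; intros; lra | intros; apply Hd; [exact Hy | lra] |].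
      rewrite Rabs_minus_sym, Ec, Rabs_mult, (Rabs_minus_sym t s).
      apply Rmult_le_compat_r; [apply Rabs_pos|]. apply Gb; [lra|].
      rewrite Rabs_left1 in H2 |- * by lra. lra.
    - rewrite !Rminus_diag, Rabs_R0. lra.
    - destruct (MVT_in Ici (f y) (g y) t s) as [c [Hc' Ec]];
        [exact Hst | unfold Ici; intros; lra | intros; apply Hd; [exact Hy | lra] |].
      rewrite Ec, Rabs_mult.
      apply Rmult_le_compat_r; [apply Rabs_pos|]. apply Gb; [lra|].
      rewrite Rabs_pos_eq in H2 |- * by lra. lra. }
  assert (T' : M * Rabs (s - t) < e / 2).
  { apply Rlt_le_trans with (M * (e / 2 / M)).
    - apply Rmult_lt_compat_l; lra.
    - apply Req_le. field. lra. }
  generalize (Kb y Hy ltac:(lra)). intros X.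
  replace (f y s - f x t) with ((f y s - f y t) + (f y t - f x t)) by ring.
  eapply Rle_lt_trans; [apply Rabs_triang | lra].
Qed.

(** The norm of [C^k] dominates every [x]-derivative, so convergence of the quotients in this norm
    yields [d_t d_x^i f = d_x^i g], and continuity of [g] in it yields joint continuity. *)
Lemma in_C1_Ck_tower (k : nat) (L : R) (f : R -> R -> R) :
  0 < L -> in_C1_Ck k L f -> exists G, tower k L (dnx L f) G.
Proof.
  intros HL [Hf [g [Hg [Hd Hc]]]]. exists (dnx L g).
  assert (Ht : forall i x t, (i <= k)%nat -> Icc L x -> 0 <= t ->
     has_deriv Ici (dnx L f i x) t (dnx L g i x t)).
  { intros i x t Hi Hx Ht e He.
    destruct (Hd t e Ht He) as [d [Hdp K]]. exists d. split; [exact Hdp|].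
    intros s [[Hs N] Hst]. specialize (K s Hs (not_eq_sym N) Hst).
    apply Ck_norm_lt with (i := i) (x := x) in K; trivial.
    rewrite (Derive_n_in_eq L k _
      (fun i x => (dnx L f i x s - dnx L f i x t) / (s - t) - dnx L g i x t) HL) in K; trivial.
    intros j y Hj Hy. apply has_deriv_minus; [|apply (in_Ck_deriv k); auto].
    apply has_deriv_div.
    apply has_deriv_minus; apply (in_Ck_deriv k L (fun y => f y _)); auto. }
  assert (Jg : forall i, (i <= k)%nat -> jcont L (dnx L g i)).
  { intros i Hi x t Hx Htp e He.
    destruct (Hc t (e / 2) Htp ltac:(lra)) as [d [Hdp K]].
    destruct (in_Ck_cont k L _ i x HL (Hg t Htp) Hi Hx (e / 2) ltac:(lra)) as [d' [Hd' K']].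
    exists (Rmin d d'). split; [now apply Rmin_pos|]. intros y s Hy Hs H1 H2.
    generalize (Rmin_l d d') (Rmin_r d d'). intros.
    specialize (K s Hs ltac:(lra)). specialize (K' y Hy ltac:(lra)).
    apply Ck_norm_lt with (i := i) (x := y) in K; trivial.
    rewrite (Derive_n_in_eq L k _ (fun i x => dnx L g i x s - dnx L g i x t) HL) in K; trivial.
    - fold (dnx L g i y t) (dnx L g i x t) in K'.
      replace (dnx L g i y s - dnx L g i x t)
        with ((dnx L g i y s - dnx L g i y t) + (dnx L g i y t - dnx L g i x t)) by ring.
      eapply Rle_lt_trans; [apply Rabs_triang | lra].
    - intros j z Hj Hz.
      apply has_deriv_minus; apply (in_Ck_deriv k L (fun y => g y _)); auto. }
  split; [|split; [|split; [|split]]]; trivial.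
  - intros i x t Hi Hx Htp. apply (in_Ck_deriv k L (fun y => f y t)); auto.
  - intros i x t Hi Hx Htp. apply (in_Ck_deriv k L (fun y => g y t)); auto.
  - intros i Hi. apply jcont_of_deriv with (dnx L g i); auto.
    intros x t Hx Htp. apply (in_Ck_cont k L (fun y => f y t)); auto.
Qed.

(** Points of the closed strip are limits of interior points at positive times, where (P) gives its
    equations. To be applied to the defect of each equation. *)
Lemma jcont_zero (L : R) (f : R -> R -> R) :
  0 < L -> jcont L f -> (forall x t, 0 < x < L -> 0 < t -> f x t = 0) ->
  forall x t, Icc L x -> 0 <= t -> f x t = 0.
Proof.
  intros HL Hf H0 x t Hx Ht. destruct (Req_dec (f x t) 0) as [E|N]; [exact E|exfalso].
  destruct (Hf x t Hx Ht (Rabs (f x t)) (Rabs_pos_lt _ N)) as [d [Hd K]].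
  set (r := Rmin d L / 4).
  assert (Hr : 0 < r) by (generalize (Rmin_pos d L Hd HL); unfold r; lra).
  assert (Hrd : r < d) by (generalize (Rmin_l d L); unfold r in *; lra).
  assert (HrL : r <= L / 4) by (generalize (Rmin_r d L); unfold r in *; lra).
  unfold Icc in *.
  assert (Y : exists y, 0 < y < L /\ Rabs (y - x) < d).
  { destruct (Rle_dec x (L / 2)).
    - exists (x + r). rewrite Rabs_pos_eq; lra.
    - exists (x - r). rewrite Rabs_left; lra. }
  destruct Y as [y [Hy Hxy]].
  specialize (K y (t + r) ltac:(lra) ltac:(lra) Hxy).
  rewrite (H0 y (t + r) Hy ltac:(lra)), Rminus_0_l, Rabs_Ropp in K.
  replace (t + r - t) with r in K by ring. rewrite (Rabs_pos_eq r) in K by lra.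
  specialize (K Hrd). lra.
Qed.

(** The mean value theorem for [(x - a) (f1 a + f1 x) / 2 - f x] expresses the error as the
    derivative of this function at some [x]; a second use, for [f1], rewrites it as
    [(x - a) / 2 * (f2 x - f2 c)], and a third bounds this by [f3]. The constant is not the sharp
    [1/12]. *)
Lemma trapezoid_error (L a b B : R) (f f1 f2 f3 : R -> R) :
  Icc L a -> Icc L b -> a < b ->
  (forall x, Icc L x -> has_deriv (Icc L) f x (f1 x)) ->
  (forall x, Icc L x -> has_deriv (Icc L) f1 x (f2 x)) ->
  (forall x, Icc L x -> has_deriv (Icc L) f2 x (f3 x)) ->
  (forall x, Icc L x -> Rabs (f3 x) <= B) ->
  Rabs ((f1 a + f1 b) / 2 - (f b - f a) / (b - a)) <= B * (b - a) ^ 2.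
Proof.
  unfold Icc. intros Ha Hb Hab H0 H1 H2 H3.
  assert (HB : 0 <= B) by (eapply Rle_trans; [apply Rabs_pos | exact (H3 a Ha)]).
  destruct (MVT_in (Icc L) (fun x => (x - a) * ((f1 a + f1 x) / 2) - f x)
    (fun x => (1 - 0) * ((f1 a + f1 x) / 2) + (x - a) * ((0 + f2 x) / 2) - f1 x) a b)
    as [x [Hx E]]; [exact Hab | unfold Icc; intros; lra | |].
  - intros x Hx. assert (Hx' : 0 <= x <= L) by lra.
    apply has_deriv_minus; [|now apply H0].
    apply (has_deriv_mult (Icc L) (fun x => x - a) (fun x => (f1 a + f1 x) / 2)).
    + apply has_deriv_is_derive. auto_derive; [exact I | ring].
    + apply (has_deriv_div (Icc L) 2 (fun x => f1 a + f1 x)).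
      apply (has_deriv_plus (Icc L) (fun _ => f1 a)); [apply has_deriv_const | now apply H1].
  - rewrite Rminus_diag in E.
    replace ((f1 a + f1 b) / 2 - (f b - f a) / (b - a))
      with ((1 - 0) * ((f1 a + f1 x) / 2) + (x - a) * ((0 + f2 x) / 2) - f1 x).
    2:{ apply Rmult_eq_reg_r with (b - a); [|lra]. rewrite <- E. field. lra. }
    clear E. destruct (Req_dec a x) as [<-|N].
    { replace (_ - _) with 0 by field. rewrite Rabs_R0.
      apply Rmult_le_pos; [exact HB | apply pow2_ge_0]. }
    destruct (MVT_in (Icc L) f1 f2 a x) as [c [Hc E1]];
      [lra | unfold Icc; intros; lra | intros; apply H1; unfold Icc; lra |].
    assert (E2 : Rabs (f2 x - f2 c) <= B * (b - a)).
    { destruct (Req_dec c x) as [->|N'].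
      { rewrite Rminus_diag, Rabs_R0. nra. }
      destruct (MVT_in (Icc L) f2 f3 c x) as [z [Hz E2]];
        [lra | unfold Icc; intros; lra | intros; apply H2; unfold Icc; lra |].
      rewrite E2, Rabs_mult, (Rabs_pos_eq (x - c)) by lra.
      apply Rmult_le_compat; [apply Rabs_pos | lra | apply H3; lra | lra]. }
    replace (_ - f1 x) with ((f2 x - f2 c) * ((x - a) / 2))
      by (replace (f1 x) with (f1 a + f2 c * (x - a)) by lra; field).
    rewrite Rabs_mult, (Rabs_pos_eq ((x - a) / 2)) by lra.
    replace (B * (b - a) ^ 2) with (B * (b - a) * (b - a)) by ring.
    apply Rmult_le_compat; [apply Rabs_pos | lra | exact E2 | lra].
Qed.

(** * Differentiation of the equations and of the boundary conditions *)

Lemma has_deriv_congr (D : R -> Prop) (f g : R -> R) (x l m : R) :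
  adhDa (D_x D x) x -> D x -> (forall y, D y -> f y = g y) ->
  has_deriv D f x l -> has_deriv D g x m -> l = m.
Proof.
  intros A Dx E Hf Hg. apply (has_deriv_unique D g x); trivial.
  now apply has_deriv_ext with f.
Qed.

(* With [c1, c2, c] the entries of a row of [S] and of [R] this is a row of
   [R^-1 S], the matrix of the wave operator [u_tt = R^-1 S u_xx]. *)
Definition lin (c1 c2 c : R) (f g : R -> R -> R) (x t : R) : R :=
  (c1 * f x t - c2 * g x t) / c.

Lemma has_deriv_lin (D : R -> Prop) (c1 c2 c : R) (f g : R -> R) (x l m : R) :
  has_deriv D f x l -> has_deriv D g x m ->
  has_deriv D (fun y => (c1 * f y - c2 * g y) / c) x ((c1 * l - c2 * m) / c).
Proof.
  intros Hf Hg. apply has_deriv_div, has_deriv_minus; now apply has_deriv_scal.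
Qed.

Lemma jcont_lin (L c1 c2 c : R) (f g : R -> R -> R) :
  jcont L f -> jcont L g -> jcont L (lin c1 c2 c f g).
Proof.
  intros Hf Hg x t Hx Ht e He.
  destruct (jcont_plus L _ _ (jcont_scal L (c1 / c) f Hf) (jcont_scal L (- (c2 / c)) g Hg)
    x t Hx Ht e He) as [d [Hd K]].
  exists d. split; [exact Hd|]. intros y s Hy Hs H1 H2.
  specialize (K y s Hy Hs H1 H2). cbv beta in K. unfold lin.
  now replace ((c1 * f y s - c2 * g y s) / c - (c1 * f x t - c2 * g x t) / c)
    with (c1 / c * f y s + - (c2 / c) * g y s - (c1 / c * f x t + - (c2 / c) * g x t))
    by (unfold Rdiv; ring).
Qed.

(** Derivatives enter as separate functions, so the same relation can be stated for the equations
    after any number of differentiations. *)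
Definition pde (rho mu alpha beta gamma : R)
    (u1x u2x w1x w2x u1t u2t w1t w2t : R -> R -> R) (x t : R) : Prop :=
  u1t x t = w1x x t /\ u2t x t = w2x x t /\
  rho * w1t x t = alpha * u1x x t - gamma * beta * u2x x t /\
  mu * w2t x t = beta * u2x x t - gamma * beta * u1x x t.

Definition bcond (L alpha beta gamma k1 k2 : R) (u1 u2 w1 w2 : R -> R -> R) (t : R) : Prop :=
  w1 0 t = 0 /\ w2 0 t = 0 /\
  alpha * u1 L t - gamma * beta * u2 L t = - k1 * w1 L t /\
  beta * u2 L t - gamma * beta * u1 L t = - k2 * w2 L t.

Lemma bcond_deriv (L alpha beta gamma k1 k2 : R)
    (u1 u2 w1 w2 u1t u2t w1t w2t : R -> R -> R) :
  0 < L ->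
  (forall t, 0 <= t -> bcond L alpha beta gamma k1 k2 u1 u2 w1 w2 t) ->
  (forall x t, Icc L x -> 0 <= t ->
     has_deriv Ici (u1 x) t (u1t x t) /\ has_deriv Ici (u2 x) t (u2t x t) /\
     has_deriv Ici (w1 x) t (w1t x t) /\ has_deriv Ici (w2 x) t (w2t x t)) ->
  forall t, 0 <= t -> bcond L alpha beta gamma k1 k2 u1t u2t w1t w2t t.
Proof.
  intros HL B D t Ht.
  assert (I0 : Icc L 0) by (unfold Icc; lra). assert (I1 : Icc L L) by (unfold Icc; lra).
  destruct (D 0 t I0 Ht) as [_ [_ [D3 D4]]]. destruct (D L t I1 Ht) as [E1 [E2 [E3 E4]]].
  assert (A := adhDa_Ici t Ht).
  split; [|split; [|split]].
  - apply (has_deriv_congr Ici (w1 0) (fun _ => 0) t); trivial; [|apply has_deriv_const].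
    intros s Hs. apply (B s Hs).
  - apply (has_deriv_congr Ici (w2 0) (fun _ => 0) t); trivial; [|apply has_deriv_const].
    intros s Hs. apply (B s Hs).
  - apply (has_deriv_congr Ici (fun s => alpha * u1 L s - gamma * beta * u2 L s)
      (fun s => - k1 * w1 L s) t); trivial.
    + intros s Hs. apply (B s Hs).
    + apply has_deriv_minus; now apply has_deriv_scal.
    + now apply has_deriv_scal.
  - apply (has_deriv_congr Ici (fun s => beta * u2 L s - gamma * beta * u1 L s)
      (fun s => - k2 * w2 L s) t); trivial.
    + intros s Hs. apply (B s Hs).
    + apply has_deriv_minus; now apply has_deriv_scal.
    + now apply has_deriv_scal.
Qed.

Lemma pde_deriv_x (L rho mu alpha beta gamma : R)
    (a1 a2 b1 b2 u1t u2t w1t w2t a1' a2' b1' b2' u1t' u2t' w1t' w2t' : R -> R -> R) (t : R) :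
  0 < L -> 0 <= t ->
  (forall x, Icc L x -> pde rho mu alpha beta gamma a1 a2 b1 b2 u1t u2t w1t w2t x t) ->
  (forall x, Icc L x ->
     has_deriv (Icc L) (fun y => a1 y t) x (a1' x t) /\
     has_deriv (Icc L) (fun y => a2 y t) x (a2' x t) /\
     has_deriv (Icc L) (fun y => b1 y t) x (b1' x t) /\
     has_deriv (Icc L) (fun y => b2 y t) x (b2' x t)) ->
  (forall x, Icc L x ->
     has_deriv (Icc L) (fun y => u1t y t) x (u1t' x t) /\
     has_deriv (Icc L) (fun y => u2t y t) x (u2t' x t) /\
     has_deriv (Icc L) (fun y => w1t y t) x (w1t' x t) /\
     has_deriv (Icc L) (fun y => w2t y t) x (w2t' x t)) ->
  forall x, Icc L x -> pde rho mu alpha beta gamma a1' a2' b1' b2' u1t' u2t' w1t' w2t' x t.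
Proof.
  intros HL Ht P D1 D2 x Hx.
  destruct (D1 x Hx) as [A1 [A2 [A3 A4]]]. destruct (D2 x Hx) as [B1 [B2 [B3 B4]]].
  assert (A := adhDa_Icc L x HL Hx).
  split; [|split; [|split]].
  - apply (has_deriv_congr (Icc L) (fun y => u1t y t) (fun y => b1 y t) x); trivial.
    intros y Hy. apply (P y Hy).
  - apply (has_deriv_congr (Icc L) (fun y => u2t y t) (fun y => b2 y t) x); trivial.
    intros y Hy. apply (P y Hy).
  - apply (has_deriv_congr (Icc L) (fun y => rho * w1t y t)
      (fun y => alpha * a1 y t - gamma * beta * a2 y t) x); trivial.
    + intros y Hy. apply (P y Hy).
    + now apply has_deriv_scal.
    + apply has_deriv_minus; now apply has_deriv_scal.
  - apply (has_deriv_congr (Icc L) (fun y => mu * w2t y t)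
      (fun y => beta * a2 y t - gamma * beta * a1 y t) x); trivial.
    + intros y Hy. apply (P y Hy).
    + now apply has_deriv_scal.
    + apply has_deriv_minus; now apply has_deriv_scal.
Qed.

Definition smooth_solution (L rho mu alpha beta gamma k1 k2 : R)
    (U1 U2 W1 W2 GU1 GU2 GW1 GW2 : nat -> R -> R -> R) : Prop :=
  (tower 3 L U1 GU1 /\ tower 3 L U2 GU2 /\ tower 3 L W1 GW1 /\ tower 3 L W2 GW2) /\
  (forall x t, Icc L x -> 0 <= t -> pde rho mu alpha beta gamma
     (U1 1%nat) (U2 1%nat) (W1 1%nat) (W2 1%nat)
     (GU1 0%nat) (GU2 0%nat) (GW1 0%nat) (GW2 0%nat) x t) /\
  (forall t, 0 <= t -> bcond L alpha beta gamma k1 k2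
     (U1 0%nat) (U2 0%nat) (W1 0%nat) (W2 0%nat) t).

(** Each step differentiates the equations in [x]. The index stops at 2 because order [S i] must
    stay within the three available [x]-derivatives. *)
Lemma pde_all (L rho mu alpha beta gamma k1 k2 : R)
    (U1 U2 W1 W2 GU1 GU2 GW1 GW2 : nat -> R -> R -> R) :
  0 < L -> smooth_solution L rho mu alpha beta gamma k1 k2 U1 U2 W1 W2 GU1 GU2 GW1 GW2 ->
  forall i x t, (i <= 2)%nat -> Icc L x -> 0 <= t -> pde rho mu alpha beta gamma
     (U1 (S i)) (U2 (S i)) (W1 (S i)) (W2 (S i)) (GU1 i) (GU2 i) (GW1 i) (GW2 i) x t.
Proof.
  intros HL [[[A1 [A2 _]] [[B1 [B2 _]] [[C1 [C2 _]] [D1 [D2 _]]]]] [H _]].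
  induction i as [|i IH]; intros x t Hi Hx Ht; [now apply H|].
  revert x Hx. eapply pde_deriv_x; trivial.
  - intros x Hx. apply IH; trivial. lia.
  - intros x Hx. cbv beta. repeat split; [apply A1 | apply B1 | apply C1 | apply D1];
      trivial; lia.
  - intros x Hx. cbv beta. repeat split; [apply A2 | apply B2 | apply C2 | apply D2];
      trivial; lia.
Qed.

Lemma lin_eq_l (rho c1 c2 : R) (f g h : R -> R -> R) (x t : R) :
  0 < rho -> rho * h x t = c1 * f x t - c2 * g x t -> h x t = lin c1 c2 rho f g x t.
Proof. intros Hr E. unfold lin. rewrite <- E. field. lra. Qed.

(* The wave solution is [Z = d_t^3 (u, w)], expressed through the
   [x]-derivatives that exist: [Z = R^-1 S d_t d_x^2 (u, w)]. *)
Lemma third_time_derivative (L rho mu alpha beta gamma k1 k2 : R)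
    (U1 U2 W1 W2 GU1 GU2 GW1 GW2 : nat -> R -> R -> R) :
  0 < L -> 0 < rho -> 0 < mu ->
  smooth_solution L rho mu alpha beta gamma k1 k2 U1 U2 W1 W2 GU1 GU2 GW1 GW2 ->
  let M1 := lin alpha (gamma * beta) rho in
  let M2 f g := lin beta (gamma * beta) mu g f in
  let a1 := M1 (GU1 3%nat) (GU2 3%nat) in
  let a2 := M2 (GU1 3%nat) (GU2 3%nat) in
  wave_solution L rho mu alpha beta gamma k1 k2
    (M1 (GU1 2%nat) (GU2 2%nat)) (M2 (GU1 2%nat) (GU2 2%nat))
    (M1 (GW1 2%nat) (GW2 2%nat)) (M2 (GW1 2%nat) (GW2 2%nat))
    a1 a2 (M1 (GW1 3%nat) (GW2 3%nat)) (M2 (GW1 3%nat) (GW2 3%nat)) (M1 a1 a2) (M2 a1 a2).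
Proof.
  intros HL Hr Hm Sol M1 M2 a1 a2.
  assert (PDE := pde_all L rho mu alpha beta gamma k1 k2 _ _ _ _ _ _ _ _ HL Sol).
  destruct Sol as [[[A1 [A2 [A3 [A4 A5]]]] [[B1 [B2 [B3 [B4 B5]]]]
    [[C1 [C2 [C3 [C4 C5]]]] [D1 [D2 [D3 [D4 D5]]]]]]] [_ BC]].
  (* By the equations [GU i = W (S i)], which has a time derivative; this yields second time
     derivatives although the hypotheses supply only first ones. [GWt] uses [U (S i)] in the same
     way. *)
  assert (GUt : forall i x t, (i <= 2)%nat -> Icc L x -> 0 <= t ->
     has_deriv Ici (GU1 i x) t (GW1 (S i) x t) /\ has_deriv Ici (GU2 i x) t (GW2 (S i) x t)).
  { intros i x t Hi Hx Ht. split.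
    - apply has_deriv_ext with (W1 (S i) x); [exact Ht | | apply C3; trivial; lia].
      intros s Hs. symmetry. now apply PDE.
    - apply has_deriv_ext with (W2 (S i) x); [exact Ht | | apply D3; trivial; lia].
      intros s Hs. symmetry. now apply PDE. }
  assert (GWt : forall i x t, (i <= 2)%nat -> Icc L x -> 0 <= t ->
     has_deriv Ici (GW1 i x) t (M1 (GU1 (S i)) (GU2 (S i)) x t) /\
     has_deriv Ici (GW2 i x) t (M2 (GU1 (S i)) (GU2 (S i)) x t)).
  { intros i x t Hi Hx Ht. split.
    - apply has_deriv_ext with (M1 (U1 (S i)) (U2 (S i)) x); [exact Ht | |].
      + intros s Hs. symmetry. apply lin_eq_l; [exact Hr|]. now apply PDE.
      + apply has_deriv_lin; [apply A3 | apply B3]; trivial; lia.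
    - apply has_deriv_ext with (M2 (U1 (S i)) (U2 (S i)) x); [exact Ht | |].
      + intros s Hs. symmetry. apply lin_eq_l; [exact Hm|]. now apply PDE.
      + apply has_deriv_lin; [apply B3 | apply A3]; trivial; lia. }
  (* Three differentiations carry the boundary conditions to [(u, w)_t], [(u, w)_tt] and [Z], each
     written through available [x]-derivatives. *)
  assert (BC1 : forall t, 0 <= t -> bcond L alpha beta gamma k1 k2
     (GU1 0%nat) (GU2 0%nat) (GW1 0%nat) (GW2 0%nat) t).
  { eapply bcond_deriv; [exact HL | exact BC|].
    intros x t Hx Ht. repeat split; [apply A3 | apply B3 | apply C3 | apply D3]; trivial; lia. }
  assert (BC2 : forall t, 0 <= t -> bcond L alpha beta gamma k1 k2
     (GW1 1%nat) (GW2 1%nat) (M1 (GU1 1%nat) (GU2 1%nat)) (M2 (GU1 1%nat) (GU2 1%nat)) t).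
  { eapply bcond_deriv; [exact HL | exact BC1|]. intros x t Hx Ht.
    destruct (GUt 0%nat x t) as [X1 X2]; trivial; [lia|].
    destruct (GWt 0%nat x t) as [Y1 Y2]; trivial; [lia|]. now repeat split. }
  assert (BC3 : forall t, 0 <= t -> bcond L alpha beta gamma k1 k2
     (M1 (GU1 2%nat) (GU2 2%nat)) (M2 (GU1 2%nat) (GU2 2%nat))
     (M1 (GW1 2%nat) (GW2 2%nat)) (M2 (GW1 2%nat) (GW2 2%nat)) t).
  { eapply bcond_deriv; [exact HL | exact BC2|]. intros x t Hx Ht.
    destruct (GUt 1%nat x t) as [X1 X2]; trivial; [lia|].
    destruct (GWt 1%nat x t) as [Y1 Y2]; trivial; [lia|].
    repeat split; trivial; now apply has_deriv_lin. }
  assert (J1 := A5 3%nat ltac:(lia)). assert (J2 := B5 3%nat ltac:(lia)).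
  assert (J3 := C5 3%nat ltac:(lia)). assert (J4 := D5 3%nat ltac:(lia)).
  assert (JA1 : jcont L a1) by now apply jcont_lin.
  assert (JA2 : jcont L a2) by now apply jcont_lin.
  split; [|split; [|split; [|split]]].
  - intros x t Hx Ht.
    assert (X1 := A2 2%nat x t ltac:(lia) Hx Ht). assert (X2 := B2 2%nat x t ltac:(lia) Hx Ht).
    assert (X3 := C2 2%nat x t ltac:(lia) Hx Ht). assert (X4 := D2 2%nat x t ltac:(lia) Hx Ht).
    repeat split; now apply (has_deriv_lin (Icc L) _ _ _ (fun y => _ y t) (fun y => _ y t)).
  - intros x t Hx Ht.
    destruct (GUt 2%nat x t) as [X1 X2]; trivial.
    destruct (GWt 2%nat x t) as [Y1 Y2]; trivial.
    repeat split; now apply has_deriv_lin.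
  - intros x t Hx Ht. unfold M1, M2, lin. split; field; lra.
  - repeat split; trivial; now apply jcont_lin.
  - exact BC3.
Qed.

(** Undoes the wave operator. Inverting [S] in [Z] bounds [GU 2] and [GW 2] by [B1]; the former
    equal [W 3], and a second inversion in [R GW 2 = S U 3] bounds [U 3] by [B2]. *)
Lemma third_x_derivative_bounded (L rho mu alpha beta gamma k1 k2 : R)
    (U1 U2 W1 W2 GU1 GU2 GW1 GW2 : nat -> R -> R -> R) :
  0 < L -> 0 < rho -> 0 < mu -> 0 < alpha -> 0 < beta -> 0 < gamma ->
  0 < alpha1 alpha beta gamma -> 0 < k1 -> 0 < k2 ->
  smooth_solution L rho mu alpha beta gamma k1 k2 U1 U2 W1 W2 GU1 GU2 GW1 GW2 ->
  exists B, 0 < B /\ forall x t, Icc L x -> 0 <= t ->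
    Rabs (U1 3%nat x t) <= B /\ Rabs (U2 3%nat x t) <= B /\
    Rabs (W1 3%nat x t) <= B /\ Rabs (W2 3%nat x t) <= B.
Proof.
  intros HL Hr Hm Hal Hb Hg Ha Hk1 Hk2 Sol.
  destruct (wave_bounded L rho mu alpha beta gamma k1 k2 _ _ _ _ _ _ _ _ _ _
    HL Hr Hm Hal Hb Hg Ha Hk1 Hk2
    (third_time_derivative L rho mu alpha beta gamma k1 k2 _ _ _ _ _ _ _ _ HL Hr Hm Sol))
    as [B HB].
  assert (PDE := pde_all L rho mu alpha beta gamma k1 k2 _ _ _ _ _ _ _ _ HL Sol).
  destruct (stress_bound alpha beta gamma Hb Hg Ha) as [C [HC SB]].
  assert (HB0 : 0 <= B).
  { destruct (HB 0 0) as [X _]; [unfold Icc; lra | lra|].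
    eapply Rle_trans; [apply Rabs_pos | exact X]. }
  set (B1 := C * ((rho + mu) * B)). set (B2 := C * ((rho + mu) * B1)).
  assert (P1 : 0 <= B1) by (unfold B1; apply Rmult_le_pos; nra).
  assert (P2 : 0 <= B2) by (unfold B2; apply Rmult_le_pos; nra).
  exists (B1 + B2 + 1). split; [lra|]. intros x t Hx Ht.
  destruct (HB x t Hx Ht) as [X1 [X2 [X3 X4]]].
  destruct (PDE 2%nat x t (le_n 2) Hx Ht) as [E1 [E2 [E3 E4]]].
  assert (Sc : forall c z v b, 0 < c -> c <= rho + mu -> 0 <= b -> Rabs z <= b -> v = c * z ->
    Rabs v <= (rho + mu) * b).
  { intros c z v b Hc Hcm Hb' Hz ->. rewrite Rabs_mult, (Rabs_pos_eq c) by lra.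
    apply Rmult_le_compat; [lra | apply Rabs_pos | lra | exact Hz]. }
  destruct (SB (GU1 2%nat x t) (GU2 2%nat x t) ((rho + mu) * B)) as [Y1 Y2].
  { eapply (Sc rho); [lra | lra | lra | exact X1 | unfold lin; field; lra]. }
  { eapply (Sc mu); [lra | lra | lra | exact X2 | unfold lin; field; lra]. }
  destruct (SB (GW1 2%nat x t) (GW2 2%nat x t) ((rho + mu) * B)) as [Y3 Y4].
  { eapply (Sc rho); [lra | lra | lra | exact X3 | unfold lin; field; lra]. }
  { eapply (Sc mu); [lra | lra | lra | exact X4 | unfold lin; field; lra]. }
  fold B1 in Y1, Y2, Y3, Y4.
  destruct (SB (U1 3%nat x t) (U2 3%nat x t) ((rho + mu) * B1)) as [Y5 Y6].
  { eapply (Sc rho); [lra | lra | lra | exact Y3 | now rewrite E3]. }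
  { eapply (Sc mu); [lra | lra | lra | exact Y4 | now rewrite E4]. }
  fold B2 in Y5, Y6. rewrite E1 in Y1. rewrite E2 in Y2. lra.
Qed.

(** Closes (P) up to the lateral boundary and the initial time by continuity, because an identity
    can be differentiated relative to [Icc L] or [Ici] only if it holds on all of that set. *)
Lemma systemP_smooth (L rho mu alpha beta gamma k1 k2 : R)
    (v0 v1 p0 p1 : R -> R) (u1 u2 w1 w2 : R -> R -> R)
    (GU1 GU2 GW1 GW2 : nat -> R -> R -> R) :
  0 < L ->
  tower 3 L (dnx L u1) GU1 -> tower 3 L (dnx L u2) GU2 ->
  tower 3 L (dnx L w1) GW1 -> tower 3 L (dnx L w2) GW2 ->
  systemP L rho mu alpha beta gamma k1 k2 v0 v1 p0 p1 u1 u2 w1 w2 ->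
  smooth_solution L rho mu alpha beta gamma k1 k2
    (dnx L u1) (dnx L u2) (dnx L w1) (dnx L w2) GU1 GU2 GW1 GW2.
Proof.
  intros HL TU1 TU2 TW1 TW2 [Hpde [Hbc _]].
  split; [repeat split; try apply TU1; try apply TU2; try apply TW1; apply TW2|].
  destruct TU1 as [_ [_ [A3 [A4 A5]]]]. destruct TU2 as [_ [_ [B3 [B4 B5]]]].
  destruct TW1 as [_ [_ [C3 [C4 C5]]]]. destruct TW2 as [_ [_ [D3 [D4 D5]]]].
  assert (HI : forall x, 0 < x < L -> Icc L x) by (unfold Icc; intros; lra).
  assert (I : forall x t, 0 < x < L -> 0 < t -> pde rho mu alpha beta gamma
     (dnx L u1 1%nat) (dnx L u2 1%nat) (dnx L w1 1%nat) (dnx L w2 1%nat)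
     (GU1 0%nat) (GU2 0%nat) (GW1 0%nat) (GW2 0%nat) x t).
  { intros x t Hx Ht. destruct (Hpde x t Hx Ht) as [E1 [E2 [E3 E4]]].
    assert (Ht' : 0 <= t) by lra.
    rewrite (Dt_eq (w1 x) t _ Ht' (C3 0%nat x t ltac:(lia) (HI x Hx) Ht')) in E1.
    rewrite (Dt_eq (w2 x) t _ Ht' (D3 0%nat x t ltac:(lia) (HI x Hx) Ht')) in E2.
    rewrite (Dt_eq (u1 x) t _ Ht' (A3 0%nat x t ltac:(lia) (HI x Hx) Ht')) in E3.
    rewrite (Dt_eq (u2 x) t _ Ht' (B3 0%nat x t ltac:(lia) (HI x Hx) Ht')) in E4.
    unfold pde, dnx. simpl. repeat split; lra. }
  split.
  - assert (J1 := A4 1%nat ltac:(lia)). assert (J2 := B4 1%nat ltac:(lia)).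
    assert (J3 := C4 1%nat ltac:(lia)). assert (J4 := D4 1%nat ltac:(lia)).
    assert (K1 := A5 0%nat ltac:(lia)). assert (K2 := B5 0%nat ltac:(lia)).
    assert (K3 := C5 0%nat ltac:(lia)). assert (K4 := D5 0%nat ltac:(lia)).
    intros x t Hx Ht. split; [|split; [|split]]; apply Rminus_diag_uniq.
    + assert (Z : GU1 0%nat x t + (-1) * dnx L w1 1%nat x t = 0); [|lra].
      revert x t Hx Ht. apply (jcont_zero L _ HL).
      * apply jcont_plus; [exact K1 | now apply jcont_scal].
      * intros x t Hx Ht. destruct (I x t Hx Ht). lra.
    + assert (Z : GU2 0%nat x t + (-1) * dnx L w2 1%nat x t = 0); [|lra].
      revert x t Hx Ht. apply (jcont_zero L _ HL).
      * apply jcont_plus; [exact K2 | now apply jcont_scal].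
      * intros x t Hx Ht. destruct (I x t Hx Ht) as [_ [E _]]. lra.
    + assert (Z : rho * GW1 0%nat x t + ((- alpha) * dnx L u1 1%nat x t
        + (gamma * beta) * dnx L u2 1%nat x t) = 0); [|lra].
      revert x t Hx Ht. apply (jcont_zero L _ HL).
      * repeat apply jcont_plus; now apply jcont_scal.
      * intros x t Hx Ht. destruct (I x t Hx Ht) as [_ [_ [E _]]]. lra.
    + assert (Z : mu * GW2 0%nat x t + ((- beta) * dnx L u2 1%nat x t
        + (gamma * beta) * dnx L u1 1%nat x t) = 0); [|lra].
      revert x t Hx Ht. apply (jcont_zero L _ HL).
      * repeat apply jcont_plus; now apply jcont_scal.
      * intros x t Hx Ht. destruct (I x t Hx Ht) as [_ [_ [_ E]]]. lra.
  - assert (I0 : Icc L 0) by (unfold Icc; lra). assert (IL : Icc L L) by (unfold Icc; lra).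
    assert (Dense : forall t, 0 <= t -> forall d, 0 < d ->
      exists y, Ici y /\ 0 < y /\ Rabs (y - t) < d).
    { intros t Ht d Hd. exists (t + d / 2). unfold Ici. rewrite Rabs_pos_eq; lra. }
    intros t Ht. unfold bcond, dnx. simpl.
    assert (A3t := A3 0%nat L t ltac:(lia) IL Ht). assert (B3t := B3 0%nat L t ltac:(lia) IL Ht).
    assert (C3t := C3 0%nat L t ltac:(lia) IL Ht). assert (D3t := D3 0%nat L t ltac:(lia) IL Ht).
    assert (C30 := C3 0%nat 0 t ltac:(lia) I0 Ht). assert (D30 := D3 0%nat 0 t ltac:(lia) I0 Ht).
    unfold dnx in A3t, B3t, C3t, D3t, C30, D30. simpl in A3t, B3t, C3t, D3t, C30, D30.
    split; [|split; [|split]].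
    + apply (cont_in_eq_of_dense Ici (fun s => 0 < s) (w1 0) (fun _ => 0) t); auto.
      * eapply has_deriv_cont_in. exact C30.
      * eapply has_deriv_cont_in. apply has_deriv_const.
      * intros s Hs. now apply Hbc.
    + apply (cont_in_eq_of_dense Ici (fun s => 0 < s) (w2 0) (fun _ => 0) t); auto.
      * eapply has_deriv_cont_in. exact D30.
      * eapply has_deriv_cont_in. apply has_deriv_const.
      * intros s Hs. now apply Hbc.
    + apply (cont_in_eq_of_dense Ici (fun s => 0 < s)
        (fun s => alpha * u1 L s - gamma * beta * u2 L s) (fun s => - k1 * w1 L s) t); auto.
      * eapply has_deriv_cont_in. apply has_deriv_minus; apply has_deriv_scal; eassumption.
      * eapply has_deriv_cont_in. apply has_deriv_scal. exact C3t.
      * intros s Hs. now apply Hbc.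
    + apply (cont_in_eq_of_dense Ici (fun s => 0 < s)
        (fun s => beta * u2 L s - gamma * beta * u1 L s) (fun s => - k2 * w2 L s) t); auto.
      * eapply has_deriv_cont_in. apply has_deriv_minus; apply has_deriv_scal; eassumption.
      * eapply has_deriv_cont_in. apply has_deriv_scal. exact D3t.
      * intros s Hs. now apply Hbc.
Qed.

(** * Residuals and the error system *)

Lemma residual_bound (L rho mu alpha beta gamma k1 k2 : R)
    (u1 u2 w1 w2 : R -> R -> R) (GU1 GU2 GW1 GW2 : nat -> R -> R -> R) (B : R) :
  0 < L -> 0 < alpha -> 0 < beta -> 0 < gamma -> 0 < B ->
  smooth_solution L rho mu alpha beta gamma k1 k2
    (dnx L u1) (dnx L u2) (dnx L w1) (dnx L w2) GU1 GU2 GW1 GW2 ->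
  (forall x t, Icc L x -> 0 <= t ->
    Rabs (dnx L u1 3%nat x t) <= B /\ Rabs (dnx L u2 3%nat x t) <= B /\
    Rabs (dnx L w1 3%nat x t) <= B /\ Rabs (dnx L w2 3%nat x t) <= B) ->
  let D := (1 + alpha + beta + 2 * (gamma * beta)) * B in
  forall (N j : nat) (t : R), (j <= N)%nat -> 0 <= t ->
    Rabs (res_u L N u1 w1 j t) <= D * mesh L N ^ 2 /\
    Rabs (res_u L N u2 w2 j t) <= D * mesh L N ^ 2 /\
    Rabs (res_w1 L rho alpha beta gamma N w1 u1 u2 j t) <= D * mesh L N ^ 2 /\
    Rabs (res_w2 L mu beta gamma N w2 u1 u2 j t) <= D * mesh L N ^ 2.
Proof.
  intros HL Ha Hb Hg HB [[TU1 [TU2 [TW1 TW2]]] [PDE _]] H3 D N j t Hj Ht.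
  assert (Hgb : 0 < gamma * beta) by nra.
  assert (X0 := node_range L N j HL ltac:(lia)).
  assert (X1 := node_range L N (S j) HL ltac:(lia)).
  set (h := mesh L N). assert (Hh : 0 < h) by now apply mesh_pos.
  assert (Es := node_succ L N j). fold h in Es.
  set (x := node L N j) in *. set (x' := node L N (S j)) in *.
  assert (Eh : x' - x = h) by lra.
  assert (TE : forall f G, tower 3 L (dnx L f) G ->
     (forall y, Icc L y -> Rabs (dnx L f 3%nat y t) <= B) ->
     Rabs ((dnx L f 1%nat x t + dnx L f 1%nat x' t) / 2 - delta h (nodal L N f) j t)
     <= B * h ^ 2).
  { intros f G [Tx _] Hf. unfold delta, nodal. fold x x'. rewrite <- Eh.
    apply (trapezoid_error L x x' B (fun y => f y t) (fun y => dnx L f 1%nat y t)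
      (fun y => dnx L f 2%nat y t) (fun y => dnx L f 3%nat y t)); trivial; [lra| | |];
      intros y Hy.
    - apply (Tx 0%nat y t); trivial; lia.
    - apply (Tx 1%nat y t); trivial; lia.
    - apply (Tx 2%nat y t); trivial; lia. }
  assert (DM : forall f G, tower 3 L (dnx L f) G ->
     Dt (mid (nodal L N f) j) t = (G 0%nat x t + G 0%nat x' t) / 2).
  { intros f G [_ [_ [Tt _]]]. apply Dt_eq; [exact Ht|].
    apply has_deriv_mid; apply (Tt 0%nat); trivial; lia. }
  assert (C1 := TE u1 GU1 TU1 (fun y Hy => proj1 (H3 y t Hy Ht))).
  assert (C2 := TE u2 GU2 TU2 (fun y Hy => proj1 (proj2 (H3 y t Hy Ht)))).
  assert (C3 := TE w1 GW1 TW1 (fun y Hy => proj1 (proj2 (proj2 (H3 y t Hy Ht))))).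
  assert (C4 := TE w2 GW2 TW2 (fun y Hy => proj2 (proj2 (proj2 (H3 y t Hy Ht))))).
  (* Averaging the exact equations over the two nodes and comparing with the scheme leaves one
     trapezoidal error per spatial difference; [D] adds them with their coefficients. *)
  destruct (PDE x t X0 Ht) as [P1 [P2 [P3 P4]]].
  destruct (PDE x' t X1 Ht) as [P1' [P2' [P3' P4']]].
  unfold res_u, res_w1, res_w2, lhs_u, lhs_w1, lhs_w2. fold h.
  rewrite (DM u1 GU1 TU1), (DM u2 GU2 TU2), (DM w1 GW1 TW1), (DM w2 GW2 TW2).
  rewrite P1, P2, P1', P2'.
  set (A1 := (dnx L u1 1%nat x t + dnx L u1 1%nat x' t) / 2) in *.
  set (A2 := (dnx L u2 1%nat x t + dnx L u2 1%nat x' t) / 2) in *.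
  replace (rho * ((GW1 0%nat x t + GW1 0%nat x' t) / 2))
    with (alpha * A1 - gamma * beta * A2)
    by (unfold A1, A2; replace (rho * _) with ((rho * GW1 0%nat x t + rho * GW1 0%nat x' t) / 2)
          by field; rewrite P3, P3'; field).
  replace (mu * ((GW2 0%nat x t + GW2 0%nat x' t) / 2))
    with (beta * A2 - gamma * beta * A1)
    by (unfold A1, A2; replace (mu * _) with ((mu * GW2 0%nat x t + mu * GW2 0%nat x' t) / 2)
          by field; rewrite P4, P4'; field).
  clearbody A1 A2.
  assert (Hb2 : 0 <= B * h ^ 2) by (apply Rmult_le_pos; [lra | apply pow2_ge_0]).
  unfold D. rewrite Rmult_assoc. set (b := B * h ^ 2) in *. clearbody b.
  apply Rabs_le_between in C1, C2.
  assert (Ab : 0 <= alpha * b) by nra. assert (Bb : 0 <= beta * b) by nra.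
  assert (Gb : 0 <= gamma * beta * b) by nra.
  repeat split.
  - eapply Rle_trans; [exact C3 | lra].
  - eapply Rle_trans; [exact C4 | lra].
  - assert (T1 : - (alpha * b) <= alpha * (A1 - delta h (nodal L N u1) j t) <= alpha * b)
      by (split; nra).
    assert (T2 : - (gamma * beta * b) <= gamma * beta * (A2 - delta h (nodal L N u2) j t)
              <= gamma * beta * b) by (split; nra).
    apply Rabs_le. lra.
  - assert (T1 : - (beta * b) <= beta * (A2 - delta h (nodal L N u2) j t) <= beta * b)
      by (split; nra).
    assert (T2 : - (gamma * beta * b) <= gamma * beta * (A1 - delta h (nodal L N u1) j t)
              <= gamma * beta * b) by (split; nra).
    apply Rabs_le. lra.
Qed.

(** Linearity: the residuals are the scheme applied to the nodal values, (S) contributes zero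
    sources, and the initial data cancel because (S) samples those of (P). *)
Lemma err_systemR (L rho mu alpha beta gamma k1 k2 : R) (N : nat)
    (v0 v1 p0 p1 : R -> R) (u1 u2 w1 w2 : R -> R -> R)
    (GU1 GU2 GW1 GW2 : nat -> R -> R -> R) (U1 U2 W1 W2 : nat -> R -> R) :
  0 < L ->
  smooth_solution L rho mu alpha beta gamma k1 k2
    (dnx L u1) (dnx L u2) (dnx L w1) (dnx L w2) GU1 GU2 GW1 GW2 ->
  (forall x, Icc L x ->
     u1 x 0 = Derive_in (Icc L) v0 x /\ w1 x 0 = v1 x /\ u2 x 0 = Derive_in (Icc L) p0 x /\ w2 x 0 = p1 x) ->
  systemS L rho mu alpha beta gamma k1 k2 N v0 v1 p0 p1 U1 U2 W1 W2 ->
  systemR L rho mu alpha beta gamma k1 k2 N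
    (res_u L N u1 w1) (res_u L N u2 w2)
    (res_w1 L rho alpha beta gamma N w1 u1 u2) (res_w2 L mu beta gamma N w2 u1 u2)
    (err L N u1 U1) (err L N u2 U2) (err L N w1 W1) (err L N w2 W2).
Proof.
  intros HL [[TU1 [TU2 [TW1 TW2]]] [_ BC]] H0 [Sd [Se [Sb Si]]].
  assert (Der : forall f G, tower 3 L (dnx L f) G -> forall j t, (j <= N + 1)%nat -> 0 <= t ->
     has_deriv Ici (nodal L N f j) t (G 0%nat (node L N j) t)).
  { intros f G [_ [_ [Tt _]]] j t Hj Ht. apply (Tt 0%nat); trivial; [lia|].
    now apply node_range. }
  (* [Derive_in] is a total operator, so additivity rests on differentiability of both terms: from
     [tower] for the nodal values, from the first clause of [scheme] for the numerical solution. *)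
  assert (DE : forall f G F j t, tower 3 L (dnx L f) G ->
     (forall j t, (j <= N + 1)%nat -> 0 <= t -> derivable_in Ici (F j) t) ->
     (j <= N)%nat -> 0 <= t ->
     Dt (mid (err L N f F) j) t = Dt (mid (nodal L N f) j) t - Dt (mid F j) t).
  { intros f G F j t Tf HF Hj Ht. apply Dt_eq; [exact Ht|].
    apply has_deriv_ext with (fun s => mid (nodal L N f) j s - mid F j s); [exact Ht | |].
    - intros s _. unfold mid, err. field.
    - apply has_deriv_minus; apply has_deriv_mid_Dt; trivial;
        first [apply HF; trivial; lia | eapply has_deriv_derivable_in; apply (Der f G Tf); trivial; lia]. }
  assert (DU1 := fun j t => DE u1 GU1 U1 j t TU1 ltac:(intros; now apply Sd)).
  assert (DU2 := fun j t => DE u2 GU2 U2 j t TU2 ltac:(intros; now apply Sd)).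
  assert (DW1 := fun j t => DE w1 GW1 W1 j t TW1 ltac:(intros; now apply Sd)).
  assert (DW2 := fun j t => DE w2 GW2 W2 j t TW2 ltac:(intros; now apply Sd)).
  clear DE.
  split; [|split; [|split]].
  - assert (DD : forall f G F j t, tower 3 L (dnx L f) G ->
       derivable_in Ici (F j) t -> (j <= N + 1)%nat -> 0 <= t ->
       derivable_in Ici (err L N f F j) t).
    { intros f G F j t Tf HF Hj Ht. eexists.
      apply has_deriv_minus; [now apply (Der f G Tf) | now apply has_deriv_Dt]. }
    intros j t Hj Ht. destruct (Sd j t Hj Ht) as [D1 [D2 [D3 D4]]].
    repeat split; eapply DD; eassumption.
  - intros j t Hj Ht. destruct (Se j t Hj Ht) as [E1 [E2 [E3 E4]]].
    assert (Hh := mesh_pos L N HL).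
    unfold res_u, res_w1, res_w2, lhs_u, lhs_w1, lhs_w2 in *.
    rewrite DU1, DU2, DW1, DW2 by assumption.
    assert (Dl : forall f F, delta (mesh L N) (err L N f F) j t
       = delta (mesh L N) (nodal L N f) j t - delta (mesh L N) F j t)
      by (intros; unfold delta, err; field; lra).
    rewrite !Dl. repeat split; lra.
  - intros t Ht. destruct (Sb t Ht) as [Z1 [Z2 [Y1 Y2]]].
    destruct (BC t Ht) as [Z1' [Z2' [Y1' Y2']]]. unfold dnx in *. simpl in *.
    unfold err, nodal, node. rewrite mesh_mult. simpl (INR 0). rewrite Rmult_0_l.
    repeat split; lra.
  - intros j Hj. destruct (Si j Hj) as [I1 [I2 [I3 I4]]].
    destruct (H0 (node L N j) (node_range L N j HL Hj)) as [J1 [J2 [J3 J4]]].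
    unfold err, nodal. repeat split; lra.
Qed.

Lemma energy_initial_zero (L rho mu alpha beta gamma k1 k2 : R) (N : nat)
    (r1 r2 s1 s2 th1 th2 et1 et2 : nat -> R -> R) :
  systemR L rho mu alpha beta gamma k1 k2 N r1 r2 s1 s2 th1 th2 et1 et2 ->
  energy L rho mu alpha beta gamma N th1 th2 et1 et2 0 = 0.
Proof.
  intros [_ [_ [_ H]]]. rewrite energy_quad.
  rewrite (sum_eq _ (fun _ => 0)).
  - rewrite sum_cte. ring.
  - intros j Hj. destruct (H j ltac:(lia)) as [A1 [A2 [A3 A4]]].
    destruct (H (S j) ltac:(lia)) as [B1 [B2 [B3 B4]]].
    unfold quad, mid. rewrite A1, A2, A3, A4, B1, B2, B3, B4. field.
Qed.

(** * Constants of the estimate and conclusion *)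

Lemma const_C1_pos (L rho mu alpha beta gamma dlt : R) :
  0 < L -> 0 < rho -> 0 < dlt -> 0 < const_C1 L rho mu alpha beta gamma dlt.
Proof.
  intros HL Hr Hd. unfold const_C1. eapply Rlt_le_trans; [|apply Rmax_l].
  apply Rplus_lt_le_0_compat; [apply Rdiv_lt_0_compat; lra|].
  apply Rmult_le_pos; [nra | apply sqrt_pos].
Qed.

Lemma const_C2_pos (rho mu alpha beta gamma : R) :
  0 < rho -> 0 < const_C2 rho mu alpha beta gamma.
Proof. intros Hr. eapply Rlt_le_trans; [exact Hr | apply Rmax_l]. Qed.

(** Keeps the denominator [1 - dlt L eta] of the final estimate positive. *)
Lemma delta_bound_lt (L rho mu alpha beta gamma k1 k2 dlt : R) :
  0 < L -> 0 < rho -> 0 < alpha1 alpha beta gamma ->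
  dlt < delta_bound L rho mu alpha beta gamma k1 k2 ->
  dlt * L * eta_const rho mu alpha beta gamma < 1.
Proof.
  intros HL Hr Ha H.
  assert (He : 0 < eta_const rho mu alpha beta gamma).
  { unfold eta_const. eapply Rlt_le_trans; [|apply Rmax_l].
    apply Rplus_lt_le_0_compat; [|apply sqrt_pos].
    apply sqrt_lt_R0. now apply Rdiv_lt_0_compat. }
  assert (X : dlt < 1 / (L * eta_const rho mu alpha beta gamma))
    by (eapply Rlt_le_trans; [exact H | apply Rmin_l]).
  set (eta := eta_const rho mu alpha beta gamma) in *.
  apply (Rmult_lt_compat_r (L * eta)) in X; [|nra].
  replace (1 / (L * eta) * (L * eta)) with 1 in X by (field; lra). lra.
Qed.

Theorem theorem3p9 :
  forall (L rho mu alpha beta gamma k1 k2 dlt : R)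
    (hL : 0 < L) (hrho : 0 < rho) (hmu : 0 < mu) (halpha : 0 < alpha)
    (hbeta : 0 < beta) (hgamma : 0 < gamma)
    (halpha1 : 0 < alpha1 alpha beta gamma)
    (hk1 : 0 < k1) (hk2 : 0 < k2)
    (hdlt : 0 < dlt)
    (hdlt_lt : dlt < delta_bound L rho mu alpha beta gamma k1 k2)
    (v0 v1 p0 p1 : R -> R) (u1 u2 w1 w2 : R -> R -> R)
    (hu1 : in_C1_Ck 3 L u1) (hu2 : in_C1_Ck 3 L u2)
    (hw1 : in_C1_Ck 3 L w1) (hw2 : in_C1_Ck 3 L w2)
    (hP : systemP L rho mu alpha beta gamma k1 k2 v0 v1 p0 p1 u1 u2 w1 w2),
  let eta := eta_const rho mu alpha beta gamma in
  let c1 := const_C1 L rho mu alpha beta gamma dlt in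
  let c2 := const_C2 rho mu alpha beta gamma in
  let r1 N := res_u L N u1 w1 in
  let r2 N := res_u L N u2 w2 in
  let s1 N := res_w1 L rho alpha beta gamma N w1 u1 u2 in
  let s2 N := res_w2 L mu beta gamma N w2 u1 u2 in
  (forall (N : nat) (U1 U2 W1 W2 : nat -> R -> R),
     systemS L rho mu alpha beta gamma k1 k2 N v0 v1 p0 p1 U1 U2 W1 W2 ->
     systemR L rho mu alpha beta gamma k1 k2 N (r1 N) (r2 N) (s1 N) (s2 N)
       (err L N u1 U1) (err L N u2 U2) (err L N w1 W1) (err L N w2 W2)) /\
  exists D : R, 0 < D /\
    (forall (N j : nat) (t : R), (j <= N)%nat -> 0 <= t ->
       Rabs (r1 N j t) <= D * mesh L N ^ 2 /\
       Rabs (r2 N j t) <= D * mesh L N ^ 2 /\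
       Rabs (s1 N j t) <= D * mesh L N ^ 2 /\
       Rabs (s2 N j t) <= D * mesh L N ^ 2) /\
    (forall (N : nat) (U1 U2 W1 W2 : nat -> R -> R),
       systemS L rho mu alpha beta gamma k1 k2 N v0 v1 p0 p1 U1 U2 W1 W2 ->
       let e := energy L rho mu alpha beta gamma N
                  (err L N u1 U1) (err L N u2 U2)
                  (err L N w1 W1) (err L N w2 W2) in
       forall t : R, 0 <= t ->
         e t <= (1 + dlt * L * eta) / (1 - dlt * L * eta)
                  * exp (- (dlt * (1 - dlt * L * eta) / 2) * t) * e 0
                + 2 * c1 ^ 2 * c2 * D ^ 2 * mesh L N ^ 4
                  / (dlt ^ 2 * (1 - dlt * L * eta) ^ 2)).
Proof.
  intros.
  assert (HF : exists GU1 GU2 GW1 GW2, smooth_solution L rho mu alpha beta gamma k1 k2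
    (dnx L u1) (dnx L u2) (dnx L w1) (dnx L w2) GU1 GU2 GW1 GW2).
  { destruct (in_C1_Ck_tower 3 L u1 hL hu1) as [GU1 T1].
    destruct (in_C1_Ck_tower 3 L u2 hL hu2) as [GU2 T2].
    destruct (in_C1_Ck_tower 3 L w1 hL hw1) as [GW1 T3].
    destruct (in_C1_Ck_tower 3 L w2 hL hw2) as [GW2 T4].
    exists GU1, GU2, GW1, GW2. eapply systemP_smooth; eassumption. }
  destruct HF as [GU1 [GU2 [GW1 [GW2 Sol]]]].
  assert (Rsys : forall (N : nat) (U1 U2 W1 W2 : nat -> R -> R),
     systemS L rho mu alpha beta gamma k1 k2 N v0 v1 p0 p1 U1 U2 W1 W2 ->
     systemR L rho mu alpha beta gamma k1 k2 N (r1 N) (r2 N) (s1 N) (s2 N)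
       (err L N u1 U1) (err L N u2 U2) (err L N w1 W1) (err L N w2 W2)).
  { intros N U1 U2 W1 W2 HS. refine (err_systemR L rho mu alpha beta gamma k1 k2 N v0 v1 p0 p1
      u1 u2 w1 w2 GU1 GU2 GW1 GW2 U1 U2 W1 W2 hL Sol _ HS).
    intros x Hx. destruct hP as [_ [_ H]]. destruct (H x Hx) as [_ [_ [A [B [C D]]]]].
    now repeat split. }
  split; [exact Rsys|].
  destruct (third_x_derivative_bounded L rho mu alpha beta gamma k1 k2 _ _ _ _ _ _ _ _
    hL hrho hmu halpha hbeta hgamma halpha1 hk1 hk2 Sol) as [B [HB HB3]].
  assert (Res := residual_bound L rho mu alpha beta gamma k1 k2 u1 u2 w1 w2
    GU1 GU2 GW1 GW2 B hL halpha hbeta hgamma HB Sol HB3). cbv zeta in Res.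
  set (D0 := (1 + alpha + beta + 2 * (gamma * beta)) * B) in Res.
  assert (HD0 : 0 < D0).
  { unfold D0. assert (0 < gamma * beta) by nra. apply Rmult_lt_0_compat; lra. }
  destruct (scheme_stable L rho mu alpha beta gamma k1 k2
    hL hrho hmu halpha hbeta hgamma halpha1 hk1 hk2) as [K [HK ST]].
  assert (Hlt : dlt * L * eta < 1)
    by exact (delta_bound_lt L rho mu alpha beta gamma k1 k2 dlt hL hrho halpha1 hdlt_lt).
  assert (Hc1 : 0 < c1) by exact (const_C1_pos L rho mu alpha beta gamma dlt hL hrho hdlt).
  assert (Hc2 : 0 < c2) by exact (const_C2_pos rho mu alpha beta gamma hrho).
  clearbody eta c1 c2.
  (* The factor of [D^2 h^4] in the claimed bound. *)
  set (q := 2 * c1 ^ 2 * c2 / (dlt ^ 2 * (1 - dlt * L * eta) ^ 2)).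
  assert (Hden : 0 < dlt ^ 2 * (1 - dlt * L * eta) ^ 2)
    by (apply Rmult_lt_0_compat; apply pow_lt; lra).
  assert (Hq : 0 < q).
  { apply Rdiv_lt_0_compat; [|exact Hden]. assert (0 < c1 ^ 2) by now apply pow_lt. nra. }
  assert (HKq : 0 < K / q) by now apply Rdiv_lt_0_compat.
  (* [dlt], [c1] and [c2] are fixed before [D], and [N] comes after it. The factor [1 + K/q >= 1]
     preserves the residual bounds, while [q (1 + K/q)^2 >= K] makes the error term dominate the
     stability bound [K (D0 h^2)^2]. *)
  exists (D0 * (1 + K / q)). split; [|split].
  - apply Rmult_lt_0_compat; lra.
  - intros N j t Hj Ht.
    assert (X : D0 * mesh L N ^ 2 <= D0 * (1 + K / q) * mesh L N ^ 2)
      by (apply Rmult_le_compat_r; [apply pow2_ge_0 | nra]).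
    destruct (Res N j t Hj Ht) as [R1 [R2 [R3 R4]]].
    repeat split; (eapply Rle_trans; [eassumption | exact X]).
  - intros N U1 U2 W1 W2 HS e t Ht.
    specialize (Rsys N U1 U2 W1 W2 HS).
    (* With exact initial data the exponential term vanishes, and stability leaves the squared
       residual bound alone. *)
    assert (E0 : e 0 = 0) by exact (energy_initial_zero _ _ _ _ _ _ _ _ _ _ _ _ _ _ _ _ _ Rsys).
    assert (Et : e t <= K * (e 0 + (D0 * mesh L N ^ 2) ^ 2)).
    { eapply ST; [exact Ht | exact Rsys|]. intros j s Hj Hs. exact (Res N j s Hj (proj1 Hs)). }
    rewrite E0, Rplus_0_l in Et. rewrite E0, Rmult_0_r, Rplus_0_l.
    eapply Rle_trans; [exact Et|].
    replace (2 * c1 ^ 2 * c2 * (D0 * (1 + K / q)) ^ 2 * mesh L N ^ 4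
      / (dlt ^ 2 * (1 - dlt * L * eta) ^ 2))
      with (q * (1 + K / q) ^ 2 * (D0 * mesh L N ^ 2) ^ 2)
      by (unfold q at 1; field; lra).
    apply Rmult_le_compat_r; [apply pow2_ge_0|].
    replace (q * (1 + K / q) ^ 2) with (q + 2 * K + K * (K / q)) by (field; lra).
    nra.
Qed.
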